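(* Let $G$ be a (Hausdorff) topological group definable in a first order structure $M$ such that there is a basis of open neighborhoods of $e$ consisting of definable sets. If $G$ is definably topologically extremely amenable, then $G^*={G^*}^{000}_{\mathrm{def},\mathrm{top}}={G^*}^{00}_{\mathrm{def},\mathrm{top}}$. In particular: if $G$ is extremely amenable as a topological group, then $G^*={G^*}^{000}_{\mathrm{top}}={G^*}^{00}_{\mathrm{top}}$; if $G$ is definably extremely amenable, then $G^*={G^*}^{000}_{M}={G^*}^{00}_{M}$.
   Context: Let $\mathcal L$ be the language of $M$ and let $\mathcal L'\supseteq \mathcal L$ be any language containing relation symbols whose interpretations in $M$ range over all open subsets of $G$. ''Definable'' means $\mathcal L$-definable with parameters from $M$. Let $\mathfrak C\succ M$ be a monster model both in the sense of $\mathcal L$ and of $\mathcal L'$ (i.e. $\kappa$-saturated and strongly $\kappa$-homogeneous for a sufficiently large strong limit cardinal $\kappa$). For a subset $D$ of $G$ definable in $\mathcal L'$, $D^*$ is its interpretation in $\mathfrak C$; in particular $G^*$ is the interpretation of $G$. ''Bounded index'' means index $<\kappa$. A subset is $M$-type-definable if it is an intersection of sets definable over $M$, and $M$-invariant if it is invariant under automorphisms of $\mathfrak C$ fixing $M$ pointwise (in the indicated language). Let $\mu=\bigcap\{U^*: U \text{ an open neighborhood of } e \text{ in } G\}$. Components: ${G^*}^{00}_{M}$ is the smallest subgroup of $G^*$ of bounded index that is $M$-type-definable in $\mathcal L$; ${G^*}^{000}_M$ is the smallest subgroup of $G^*$ of bounded index that is $M$-invariant in $\mathcal L$. ${G^*}^{00}_{\mathrm{top}}$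 is the smallest bounded index subgroup of $G^*$ which is an intersection of some sets of the form $U^*$ with $U$ open in $G$. ${G^*}^{000}_{\mathrm{top}}$ is the smallest normal, bounded index subgroup of $G^*$ that is $M$-invariant in $\mathcal L'$ and contains $\mu$. Finally ${G^*}^{00}_{\mathrm{def},\mathrm{top}}:={G^*}^{00}_{\mathrm{top}}\cdot {G^*}^{00}_M$ and ${G^*}^{000}_{\mathrm{def},\mathrm{top}}:={G^*}^{000}_{\mathrm{top}}\cdot {G^*}^{000}_M$. Let $S_G(M)$ be the space of complete $\mathcal L$-types over $M$ concentrating on $G$, and $S_G^\mu(M)=S_G(M)/\!\sim_\mu$ with the quotient topology, where $p\sim_\mu q\iff \mu\cdot p(G^* )=\mu\cdot q(G^* )$ ($p(G^* )$ is the set of realizations of $p$); $G$ acts on it by $g\cdot(p/\!\sim_\mu)=(gp)/\!\sim_\mu$. $G$ is definably topologically extremely amenable if the action of $G$ on $S_G^\mu(M)$ has a fixed point. $G$ is definably extremely amenable if the action of $G$ on $S_G(M)$ by left translation has a fixed point. $G$ is extremely amenable as a topological group if every continuous action of $G$ on a nonempty compact Hausdorff space has a fixed point (equivalently, the universal topological $G$-ambit has a fixed point). *)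

(* Defs.v *)
From HB Require Import structures.
From mathcomp Require Import all_boot.
From mathcomp Require Import boolp classical_sets functions cardinality.
From mathcomp Require Import topology.

Set Implicit Arguments.
Unset Strict Implicit.
Unset Printing Implicit Defensive.

Local Open Scope classical_set_scope.
Local Open Scope card_scope.

HB.mixin Record isTopologicalGroup G of Group G & Topological G := {
  mulg_continuous : continuous (fun gh : G * G => (gh.1 * gh.2)%g : G) ;
  invg_continuous : continuous (fun g : G => (g^-1)%g : G) }.

#[short(type="topologicalGroupType")]
HB.structure Definition TopologicalGroup :=
  {G of isTopologicalGroup G & Group G & Topological G}.

Definition copair {A B T : Type} (f : A -> T) (g : B -> T) (x : A + B) : T :=
  match x with inl a => f a | inr b => g b end.

Definition the {T : Type} (x0 : T) (P : set T) : T :=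
  if pselect (exists x, P x) is left e then projT1 (cid e) else x0.

(* The default [set0] is never a subgroup, so an equation stating that a
   subgroup is [smallest_of P] includes the existence of a smallest element. *)
Definition smallest_of {T : Type} (P : set (set T)) : set T :=
  the set0 [set H | P H /\ forall H', P H' -> H `<=` H'].

Definition card_lt {T U : Type} (A : set T) (B : set U) : Prop :=
  A #<= B /\ ~ (B #<= A).

(* A cardinal is represented by a type of that cardinality. *)
Definition strong_limit (K : Type) : Prop :=
  infinite_set [set: K] /\
  forall A : set K, card_lt A [set: K] -> card_lt [set: set A] [set: K].

Record language := Language {
  fsym : Type; farity : fsym -> nat;
  rsym : Type; rarity : rsym -> nat }.

(* The extension of L by the symbols of E: up to renaming of symbols, every
   language containing L is of this form. *)
Definition lang_sum (L E : language) : language :=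
  @Language (fsym L + fsym E) (copair (@farity L) (@farity E))
            (rsym L + rsym E) (copair (@rarity L) (@rarity E)).

Inductive term (L : language) (V : Type) : Type :=
| Var of V
| App (f : fsym L) of ('I_(farity f) -> term L V).

(* [All] binds the variable [None]. A formula with variables in V and
   parameters in A is a [formula L (V + A)]. *)
Inductive formula (L : language) (V : Type) : Type :=
| Rel (r : rsym L) of ('I_(rarity r) -> term L V)
| Eq of term L V & term L V
| Bot
| Imp of formula L V & formula L V
| All of formula L (option V).

Arguments Bot {L V}.

Record structure (L : language) (T : Type) := Structure {
  fun_int : forall f : fsym L, ('I_(farity f) -> T) -> T;
  rel_int : forall r : rsym L, ('I_(rarity r) -> T) -> Prop }.

Definition reduct (L E : language) (T : Type)
    (S : structure (lang_sum L E) T) : structure L T :=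
  @Structure L T (fun f => @fun_int _ _ S (inl f))
                 (fun r => @rel_int _ _ S (inl r)).

Section Semantics.
Context {L : language} {T : Type} (S : structure L T).

Fixpoint eval {V : Type} (v : V -> T) (t : term L V) : T :=
  match t with
  | Var x => v x
  | App f ts => @fun_int _ _ S f (fun i => eval v (ts i))
  end.

Fixpoint sat {V : Type} (v : V -> T) (phi : formula L V) : Prop :=
  match phi with
  | Rel r ts => @rel_int _ _ S r (fun i => eval v (ts i))
  | Eq s t => eval v s = eval v t
  | Bot => False
  | Imp phi1 phi2 => sat v phi1 -> sat v phi2
  | All psi => forall x : T, sat (fun o => if o is Some y then v y else x) psi
  end.

(* [c] interprets the parameters. *)
Definition solset {V A : Type} (c : A -> T) (phi : formula L (V + A)) :
    set (V -> T) :=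
  [set a | sat (copair a c) phi].

Definition definable {V : Type} (D : set (V -> T)) : Prop :=
  exists phi : formula L (V + T), solset id phi = D.

Definition fin_sat {V A : Type} (c : A -> T)
    (Sigma : set (formula L (V + A))) : Prop :=
  forall F : set (formula L (V + A)), finite_set F -> F `<=` Sigma ->
    exists a, forall phi, F phi -> solset c phi a.

(* Complete types over the model T: finite satisfiability in T is consistency
   with the elementary diagram of T. *)
Definition complete_type {V : Type} (p : set (formula L (V + T))) : Prop :=
  fin_sat id p /\ forall phi, p phi \/ p (Imp phi Bot).

Definition automorphism (sigma : T -> T) : Prop :=
  [/\ bijective sigma,
      forall f ts, sigma (@fun_int _ _ S f ts) =
                   @fun_int _ _ S f (sigma \o ts)
    & forall r ts, @rel_int _ _ S r ts <-> @rel_int _ _ S r (sigma \o ts)].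

Definition saturated (K : Type) : Prop :=
  forall A : set T, card_lt A [set: K] ->
  forall Sigma : set (formula L (unit + A)), fin_sat set_val Sigma ->
    exists a : unit -> T, forall phi, Sigma phi -> solset set_val phi a.

Definition strongly_homogeneous (K : Type) : Prop :=
  forall A : set T, card_lt A [set: K] ->
  forall f : A -> T,
    (forall phi : formula L A, sat set_val phi <-> sat f phi) ->
    exists2 sigma, automorphism sigma & forall a : A, sigma (set_val a) = f a.

End Semantics.

Definition elementary (L : language) (M C : Type) (SM : structure L M)
    (SC : structure L C) (j : M -> C) : Prop :=
  forall phi : formula L M, sat SM id phi <-> sat SC j phi.

Definition monster (L : language) (K M C : Type) (SM : structure L M)
    (SC : structure L C) (j : M -> C) : Prop :=
  [/\ elementary SM SC j, saturated SC K & strongly_homogeneous SC K].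

(* G is identified with the subset [range iota] of M^n. *)

Definition mul_graph (M : Type) (n : nat) (G : groupType)
    (iota : G -> 'I_n -> M) : set ('I_n + 'I_n + 'I_n -> M) :=
  [set t | exists g h : G,
     t = copair (copair (iota g) (iota h)) (iota (g * h)%g)].

Definition definable_group (L : language) (M : Type) (SM : structure L M)
    (n : nat) (G : groupType) (iota : G -> 'I_n -> M) : Prop :=
  [/\ injective iota, definable SM (range iota)
    & definable SM (mul_graph iota)].

Definition definable_nbhs_basis (L : language) (M : Type) (SM : structure L M)
    (n : nat) (G : topologicalGroupType) (iota : G -> 'I_n -> M) : Prop :=
  forall N : set G, nbhs (1%g : G) N ->
    exists U : set G, [/\ open U, U 1%g, U `<=` N & definable SM (iota @` U)].

Definition names_opens (L : language) (M : Type) (SM : structure L M)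
    (n : nat) (G : topologicalGroupType) (iota : G -> 'I_n -> M) : Prop :=
  forall U : set G, open U ->
    exists (r : rsym L) (e : rarity r = n), forall a : 'I_n -> M,
      rel_int SM (a \o cast_ord e) <-> (iota @` U) a.

(* The language of M is L, and L' is [lang_sum L E]; M is identified with its
   image under [j] in the monster model C. *)
Section Components.
Context {L E : language} {M C : Type}.
Context (SM : structure (lang_sum L E) M) (SC : structure (lang_sum L E) C).
Context (j : M -> C) (K : Type).
Context {n : nat} {G : topologicalGroupType} (iota : G -> 'I_n -> M).

(* The interpretation in C of a set definable in L' (by elementarity it does
   not depend on the choice of the defining formula). *)
Definition star {V : Type} (D : set (V -> M)) : set (V -> C) :=
  [set a | exists2 phi : formula (lang_sum L E) (V + M),
             solset SM id phi = D & solset SC j phi a].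

Definition Gstar : set ('I_n -> C) := star (range iota).

(* The group law of [Gstar]; the value is irrelevant outside [Gstar]. *)
Definition smul (a b : 'I_n -> C) : 'I_n -> C :=
  the a [set c | star (mul_graph iota) (copair (copair a b) c)].

Definition embG (g : G) : 'I_n -> C := j \o iota g.

Definition setmul (A B : set ('I_n -> C)) : set ('I_n -> C) :=
  [set smul a b | a in A & b in B].

Definition subgroup (H : set ('I_n -> C)) : Prop :=
  [/\ H `<=` Gstar, H (embG 1%g),
      forall a b, H a -> H b -> H (smul a b)
    & forall a, H a -> exists2 b, H b & smul a b = embG 1%g].

Definition bounded_index (H : set ('I_n -> C)) : Prop :=
  card_lt [set smul a @` H | a in Gstar] [set: K].

Definition normal_in_Gstar (H : set ('I_n -> C)) : Prop :=
  forall a, Gstar a -> smul a @` H = (smul ^~ a) @` H.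

Definition invariant (L0 : language) (S : structure L0 C)
    (H : set ('I_n -> C)) : Prop :=
  forall sigma, automorphism S sigma -> (forall m, sigma (j m) = j m) ->
    forall a, H a -> H (sigma \o a).

Definition type_definable (H : set ('I_n -> C)) : Prop :=
  exists Sigma : set (formula L ('I_n + M)),
    H = \bigcap_(phi in Sigma) solset (reduct SC) j phi.

Definition open_intersection (H : set ('I_n -> C)) : Prop :=
  exists2 F : set (set G), F `<=` open &
    H = \bigcap_(U in F) star (iota @` U).

Definition mu : set ('I_n -> C) :=
  \bigcap_(U in [set U : set G | open U /\ U 1%g]) star (iota @` U).

Definition G00_M : set ('I_n -> C) :=
  smallest_of [set H | [/\ subgroup H, bounded_index H & type_definable H]].

Definition G000_M : set ('I_n -> C) :=
  smallest_of
    [set H | [/\ subgroup H, bounded_index H & invariant (reduct SC) H]].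

Definition G00_top : set ('I_n -> C) :=
  smallest_of [set H | [/\ subgroup H, bounded_index H & open_intersection H]].

Definition G000_top : set ('I_n -> C) :=
  smallest_of [set H | [/\ subgroup H, normal_in_Gstar H, bounded_index H,
                           invariant SC H & mu `<=` H]].

Definition G00_def_top : set ('I_n -> C) := setmul G00_top G00_M.

Definition G000_def_top : set ('I_n -> C) := setmul G000_top G000_M.

Definition group_types : set (set (formula L ('I_n + M))) :=
  [set p | complete_type (reduct SM) p /\
           exists2 gamma, p gamma & solset (reduct SM) id gamma = range iota].

Definition realizations (p : set (formula L ('I_n + M))) : set ('I_n -> C) :=
  \bigcap_(phi in p) solset (reduct SC) j phi.

(* g p = tp(g a / M) for a realizing p *)
Definition translate (g : G) (p : set (formula L ('I_n + M))) :
    set (formula L ('I_n + M)) :=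
  [set phi | exists2 a, realizations p a &
               solset (reduct SC) j phi (smul (embG g) a)].

Definition mu_equiv (p q : set (formula L ('I_n + M))) : Prop :=
  setmul mu (realizations p) = setmul mu (realizations q).

Definition mu_class (p : set (formula L ('I_n + M))) :
    set (set (formula L ('I_n + M))) :=
  [set q | group_types q /\ mu_equiv p q].

(* A point of the quotient of S_G(M) by [mu_equiv] is a class [mu_class p]. *)
Definition def_top_extremely_amenable : Prop :=
  exists2 p, group_types p &
    forall g : G, mu_class (translate g p) = mu_class p.

Definition def_extremely_amenable : Prop :=
  exists2 p, group_types p & forall g : G, translate g p = p.

End Components.

Definition extremely_amenable (G : topologicalGroupType) : Prop :=
  forall (X : topologicalType) (act : G -> X -> X),
    [set: X] !=set0 -> compact [set: X] -> hausdorff_space X ->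
    (forall x, act 1%g x = x) ->
    (forall g h x, act (g * h)%g x = act g (act h x)) ->
    continuous (fun gx : G * X => act gx.1 gx.2) ->
    exists x : X, forall g : G, act g x = x.

(* Main.v *)
Require Import Defs.
From HB Require Import structures.
From mathcomp Require Import all_boot.
From mathcomp Require Import boolp classical_sets functions cardinality.
From mathcomp Require Import filter topology.

Set Implicit Arguments.
Unset Strict Implicit.
Unset Printing Implicit Defensive.

Local Open Scope classical_set_scope.
Local Open Scope card_scope.

(** The three cases rest on two facts about [Gstar].

    A. Let H be a bounded index subgroup of [Gstar], invariant under the
    automorphisms fixing M. If x and y have the same type over M, then x and y
    lie in the same left coset of H, and in the same right coset
    ([same_type_same_coset], [same_type_same_right_coset]). Since M is a model,
    the type of x has a coheir: an ultrafilter on M^n gives a type over any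
    small set that is finitely satisfiable in M, and whether a formula with
    parameters c belongs to it depends only on the type of c over M. Realize it
    by a0 over M, x, y and one representative of each coset of H that meets the
    realizations of tp(x/M). Then a0 is in the coset of some representative r
    having the type of x, and the pairs (a0, r), (a0, x), (a0, y) have the same
    type over M; an automorphism moves r to x, or to y, and fixes a0, so a0 is in
    the cosets of x and of y.

    Conversely, a subgroup whose cosets are determined by types over M has
    bounded index, because there are few types ([types_bound_index]). Therefore
    the intersection of all subgroups of a given kind still has bounded index,
    and is the component of that kind.

    B. Suppose a filter base of definable sets P in G and the neighborhoods U
    of 1 satisfy: g P meets U P for every g in G, P and U. Then saturation gives,
    for every c in [Gstar], an equation c y = m x with m in mu and x, y in all
    the P* ([Gstar_factor]). If the P's generate a complete type, A provides h in
    H with x = h y, hence c = m h ([Gstar_factor_coset]). Thus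
    [Gstar] = mu H for every H as in A, and mu is contained in both topological
    components. When P ranges over the type fixed by G up
    to mu this is the first case; when the type itself is fixed one can take m
    equal to 1, which is the last case.

    For an extremely amenable topological group, the hypothesis of B is met by
    an ultrafilter F of arbitrary subsets of G. It comes from the fixed point of G
    on its greatest ambit, here the compact space of the filters generated by the
    sets U P with P in an ultrafilter and U a neighborhood of 1 ([samuel],
    [extremely_amenable_ultrafilter]); the language with names for the open sets
    then has the complete type of all formulas true on a set of F. *)

(** * Formulas *)

Lemma copair_comp {A B T U : Type} (h : T -> U) (f : A -> T) (g : B -> T) :
  h \o copair f g = copair (h \o f) (h \o g).
Proof. by apply/funext => -[]. Qed.

Lemma finite_set_ind {T : Type} (P : set T -> Prop) :
  P set0 -> (forall x A, P A -> P (x |` A)) -> forall A, finite_set A -> P A.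
Proof.
move=> P0 PU A /(@finite_seqP {classic T})[s ->].
elim: s => [|x s IH]; first by rewrite set_nil.
suff -> : [set` x :: s] = x |` [set` s] by exact: PU.
apply/seteqP; split=> y /=; rewrite inE => /predU1P.
  by case=> [->|?]; [left|right].
by [].
Qed.

Definition ord0_elim {W : Type} (i : 'I_0) : W :=
  False_rect W (notF (ltn_ord i)).

Section Renaming.
Context {L : language}.

Fixpoint rename_term {V W : Type} (f : V -> W) (t : term L V) : term L W :=
  match t with
  | Var x => @Var L W (f x)
  | App g ts => App (fun i => rename_term f (ts i))
  end.

Fixpoint rename {V : Type} (phi : formula L V) : forall W : Type, (V -> W) -> formula L W :=
  match phi with
  | Rel r ts => fun W f => Rel (fun i => rename_term f (ts i))
  | Eq s t => fun W f => Eq (rename_term f s) (rename_term f t)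
  | Bot => fun W f => Bot
  | Imp p q => fun W f => Imp (rename p f) (rename q f)
  | All p => fun W f => All (rename p (omap f))
  end.

Definition fnot {V} (phi : formula L V) := Imp phi Bot.
Definition fand {V} (phi psi : formula L V) := fnot (Imp phi (fnot psi)).
Definition ftrue {V} : formula L V := Imp Bot Bot.
Definition fex {V} (phi : formula L (option V)) := fnot (All (fnot phi)).

(** Existential quantification over a whole n-tuple: the first component of the
    tuple becomes the variable [None], and the others are quantified under it. *)
Fixpoint exn (n : nat) : forall W : Type, formula L ('I_n + W) -> formula L W :=
  match n with
  | 0 => fun W phi => rename phi (copair ord0_elim id)
  | n'.+1 => fun W phi =>
      fex (exn (rename phi (copair
        (fun i => if unlift ord0 i is Some k then inl k else inr None)
        (fun w => inr (Some w)))))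
  end.

Definition exf {V : finType} {W : Type} (phi : formula L (V + W)) :=
  @exn #|V| W (rename phi (copair (fun x => inl (enum_rank x)) inr)).
Definition allf {V : finType} {W : Type} (phi : formula L (V + W)) :=
  fnot (exf (fnot phi)).

Context {T : Type} (S : structure L T).

Lemma eval_rename V W (f : V -> W) (v : W -> T) (t : term L V) :
  Defs.eval S v (rename_term f t) = Defs.eval S (v \o f) t.
Proof.
elim: t => [x//|g ts IH] /=.
by congr fun_int; apply/funext => i; exact: IH.
Qed.

Lemma sat_rename V (phi : formula L V) W (f : V -> W) (v : W -> T) :
  sat S v (rename phi f) = sat S (v \o f) phi.
Proof.
elim: phi W f v => {V} [V r ts|V s t|V|V p IHp q IHq|V p IHp] W f v /=.
- by congr rel_int; apply/funext => i; exact: eval_rename.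
- by rewrite !eval_rename.
- by [].
- by rewrite IHp IHq.
- apply: eq_forall => x; rewrite IHp; congr (sat S _ p).
  by apply/funext => -[].
Qed.

Lemma sat_imp V (v : V -> T) phi psi :
  sat S v (Imp phi psi) = (sat S v phi -> sat S v psi).
Proof. by []. Qed.

Lemma sat_fnot V (v : V -> T) phi : sat S v (fnot phi) = (~ sat S v phi).
Proof. by []. Qed.

Lemma sat_fand V (v : V -> T) phi psi :
  sat S v (fand phi psi) = (sat S v phi /\ sat S v psi).
Proof.
apply/propext => /=; split; last by case=> ? ?; apply.
by move=> h; split; apply: contrapT => h'; apply: h.
Qed.

Lemma sat_fex V (v : V -> T) phi :
  sat S v (fex phi) = exists x : T, sat S (fun o => if o is Some y then v y else x) phi.
Proof.
apply/propext => /=; split; last by move=> [x hx] /(_ x hx).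
by move=> h; apply: contrapT => /forallNP.
Qed.

Lemma sat_exn n W (phi : formula L ('I_n + W)) (w : W -> T) :
  sat S w (exn phi) = exists a : 'I_n -> T, sat S (copair a w) phi.
Proof.
elim: n W phi w => [|n IH] W phi w.
  rewrite /= sat_rename copair_comp.
  have e (a : 'I_0 -> T) : w \o ord0_elim = a by apply/funext => -[].
  by apply/propext; split=> [h|[a]]; [exists (w \o ord0_elim)|rewrite (e a)].
rewrite [exn _]/= sat_fex; apply/propext; split.
  move=> [x]; rewrite IH => -[a]; rewrite sat_rename copair_comp => h.
  exists (fun i => if unlift ord0 i is Some k then a k else x).
  by congr (sat S (copair _ _) phi): h; apply/funext => i /=; case: unliftP.
move=> [a h]; exists (a ord0); rewrite IH; exists (a \o lift ord0).
rewrite sat_rename copair_comp; congr (sat S (copair _ _) phi): h.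
by apply/funext => i /=; case: unliftP => [k ->|->].
Qed.

Lemma sat_exf (V : finType) W (phi : formula L (V + W)) (w : W -> T) :
  sat S w (exf phi) = exists a : V -> T, sat S (copair a w) phi.
Proof.
rewrite sat_exn; apply/propext; split=> [[a]|[a h]].
  by rewrite sat_rename copair_comp; exists (a \o enum_rank).
exists (a \o enum_val); rewrite sat_rename copair_comp.
congr (sat S (copair _ _) phi): h.
by apply/funext => i /=; rewrite enum_rankK.
Qed.

Lemma sat_allf (V : finType) W (phi : formula L (V + W)) (w : W -> T) :
  sat S w (allf phi) = forall a : V -> T, sat S (copair a w) phi.
Proof.
rewrite /allf sat_fnot sat_exf; apply/propext; split=> [h a|h [a /(_ (h a))//]].
by apply: contrapT => ha; apply: h; exists a.
Qed.

End Renaming.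

(** * Formulas of a language in an extension *)

Section Lift.
Context {L E : language}.
Fixpoint lift_term {V : Type} (t : term L V) : term (lang_sum L E) V :=
  match t with
  | Var x => @Var (lang_sum L E) V x
  | App g ts => @App (lang_sum L E) V (inl g) (fun i => lift_term (ts i))
  end.

Fixpoint lift_formula {V : Type} (phi : formula L V) : formula (lang_sum L E) V :=
  match phi with
  | Rel r ts => @Rel (lang_sum L E) _ (inl r) (fun i => lift_term (ts i))
  | Eq s t => Eq (lift_term s) (lift_term t)
  | Bot => Bot
  | Imp p q => Imp (lift_formula p) (lift_formula q)
  | All p => All (lift_formula p)
  end.

Context {T : Type} (S : structure (lang_sum L E) T).

Lemma eval_lift V (v : V -> T) (t : term L V) :
  Defs.eval S v (lift_term t) = Defs.eval (reduct S) v t.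
Proof.
elim: t => [x//|g ts IH] /=.
by congr fun_int; apply/funext => i; exact: IH.
Qed.

Lemma sat_lift V (phi : formula L V) (v : V -> T) :
  sat S v (lift_formula phi) = sat (reduct S) v phi.
Proof.
elim: phi v => {V} [V r ts|V s t|V|V p IHp q IHq|V p IHp] v /=.
- by rewrite /reduct /=; congr rel_int; apply/funext => i; exact: eval_lift.
- by rewrite !eval_lift.
- by [].
- by rewrite IHp IHq.
- by apply: eq_forall => x; rewrite IHp.
Qed.
End Lift.

Lemma finite_conj (L : language) V (F : set (formula L V)) : finite_set F ->
  exists chi : formula L V, forall T (S : structure L T) (v : V -> T),
    sat S v chi <-> forall phi, F phi -> sat S v phi.
Proof.
move: F; apply: finite_set_ind => [|phi A [chi hchi]]; first by exists ftrue => T S v; split=> [_ p []|_ []].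
exists (fand phi chi) => T S v; rewrite sat_fand hchi.
split=> [[h1 h2] p [->//|]|h]; first exact: h2.
by split=> [|p Ap]; apply: h; [left|right].
Qed.
(** * Cardinals below a strong limit *)

Lemma card_le_injP {T U : Type} (A : set T) (B : set U) :
  (exists2 f : T -> U, (forall x, A x -> B (f x)) &
     (forall x y, A x -> A y -> f x = f y -> x = y)) -> A #<= B.
Proof.
move=> [f fAB finj].
have finj' : {in A &, injective f} by move=> x y /set_mem Ax /set_mem Ay; exact: finj.
rewrite -(card_le_eql (inj_card_eq finj')); apply: subset_card_le.
by move=> _ [x Ax <-]; exact: fAB.
Qed.

Lemma card_le_inj {T U : Type} (A : set T) (B : set U) (u0 : U) : A #<= B ->
  exists2 f : T -> U, (forall x, A x -> B (f x)) &
     (forall x y, A x -> A y -> f x = f y -> x = y).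
Proof.
move: B u0; elim/Ppointed: U => U B u0; first by case: (no u0).
move=> /pcard_leP [f]; exists f => [x Ax|x y Ax Ay]; first exact: funS.
by apply: inj; apply: mem_set.
Qed.

(** The graph of an injection between parts of T and U; Zorn's lemma applies to
    these graphs ordered by inclusion. *)
Definition partial_inj {T U : Type} (R : set (T * U)) :=
  forall p q, R p -> R q -> p.1 = q.1 <-> p.2 = q.2.

(** A maximal partial injection from A to B is total or surjective. *)
Lemma card_le_total {T U : Type} (A : set T) (B : set U) : A #<= B \/ B #<= A.
Proof.
pose P (R : set (T * U)) := partial_inj R /\ forall p, R p -> A p.1 /\ B p.2.
have [F FP Ftot|R [[Rinj RAB] Rmax]] := @Zorn_bigcup _ P.
  split=> [p q [X FX Xp] [Y FY Yq]|p [X /FP[_ XAB] /XAB//]].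
  have [XY|YX] := Ftot _ _ FX FY.
    by apply: (FP _ FY).1 => //; exact: XY.
  by apply: (FP _ FX).1 => //; exact: YX.
have [hA|/existsNP[a /not_implyP[Aa hA]]] :=
  pselect (forall a, A a -> exists b, R (a, b)).
  left; case: (pselect (exists u : U, True)) => [[u0 _]|nU]; last first.
    suff -> : A = set0 by exact: card_ge0.
    by apply/seteqP; split=> // a /hA[b _]; case: nU; exists b.
  pose f a := the u0 [set b | R (a, b)].
  have fP a : A a -> R (a, f a).
    by move=> /hA ex; rewrite /f /the; case: pselect => // e; exact: projT2 (cid e).
  apply: card_le_injP; exists f => [a /fP /RAB[]//|a a' /fP h /fP h' e].
  by apply/(Rinj _ _ h h').
have [hB|/existsNP[b /not_implyP[Bb hB]]] :=
  pselect (forall b, B b -> exists a, R (a, b)).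
  right; pose f b := the a [set a | R (a, b)].
  have fP b : B b -> R (f b, b).
    by move=> /hB ex; rewrite /f /the; case: pselect => // e; exact: projT2 (cid e).
  apply: card_le_injP; exists f => [b /fP /RAB[]//|b b' /fP h /fP h' e].
  by apply/(Rinj _ _ h h').
have ltR : R `<` (a, b) |` R.
  rewrite properEneq; split=> [|p Rp]; last by right.
  by apply/eqP => e; apply: hA; exists b; rewrite e; left.
case: (Rmax _ ltR); split=> [p q|p [->//|/RAB//]].
move=> [->|Rp] [->|Rq] /=; [by []| | |exact: Rinj].
  by split=> e; [case: hA; exists q.2|case: hB; exists q.1]; rewrite e; case: (q) Rq.
by split=> e; [case: hA; exists p.2|case: hB; exists p.1]; rewrite -e; case: (p) Rp.
Qed.

Section Small.
Context {K : Type} (K_limit : strong_limit K).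
Definition small {T : Type} (A : set T) := card_lt A [set: K].

Lemma le_small {T U : Type} (A : set T) (B : set U) : A #<= B -> small B -> small A.
Proof.
move=> AB [BK nKB]; split; first exact: card_le_trans AB BK.
by move=> KA; apply: nKB; exact: card_le_trans KA AB.
Qed.

Lemma small_sub {T : Type} (A B : set T) : A `<=` B -> small B -> small A.
Proof. by move=> /subset_card_le; exact: le_small. Qed.

Lemma small_image {T U : Type} (f : T -> U) (A : set T) : small A -> small (f @` A).
Proof. exact: le_small (card_image_le _ _). Qed.

Lemma small_finite {T : Type} (A : set T) : finite_set A -> small A.
Proof.
move=> Afin; have Kinf := K_limit.1.
have nKA : ~ ([set: K] #<= A) by move=> /card_le_finite /(_ Afin).
by split=> //; have [|/nKA] := card_le_total A [set: K].
Qed.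

Lemma small_powerset (T : Type) : small [set: T] -> small [set: set T].
Proof.
move=> sT; have [[k _]|nK] := pselect (exists k : K, True); last first.
  by case: K_limit.1; suff -> : [set: K] = set0 by []; apply/seteqP; split=> // k _; case: nK; exists k.
have [f _ finj] := card_le_inj k sT.1.
have sA : small (range f) by exact: small_image.
apply: le_small (K_limit.2 _ sA).
apply: card_le_injP; exists (fun S => [set a | (f @` S) (set_val a)]) => // S S' _ _ e.
have sub (X Y : set T) : [set a : range f | (f @` X) (set_val a)] =
    [set a : range f | (f @` Y) (set_val a)] -> X `<=` Y.
  move=> eXY x Xx; pose a : range f := SigSub (mem_set (imageT f x)).
  have : [set a : range f | (f @` X) (set_val a)] a by exists x.
  by rewrite eXY => -[y Yy] /= /finj <-.
by apply/seteqP; split; apply: sub.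
Qed.

(** If A embeds into B, then the union embeds into the double powerset of B:
    z in B goes to {{z}}, and z in A outside B, with image f z, goes to
    {{f z}, {}}. This avoids the equation k + k = k for infinite cardinals. *)
Lemma smallU {T : Type} (A B : set T) : small A -> small B -> small (A `|` B).
Proof.
wlog AB : A B / A #<= B.
  have [AB|BA] := card_le_total A B; first exact.
  by move=> h sA sB; rewrite setUC; apply: h.
move=> sA sB.
have [->|/set0P[b0 Bb0]] := eqVneq B set0; first by rewrite setU0.
have [f fB finj] := card_le_inj b0 AB.
have [[k _]|nK] := pselect (exists k : K, True); last first.
  by case: K_limit.1; suff -> : [set: K] = set0 by []; apply/seteqP; split=> // k _; case: nK; exists k.
have sB' : small [set: B].
  apply: le_small sB; apply: card_le_injP; exists set_val => [x _|x y _ _ /val_inj//].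
  exact: set_mem (valP x).
have sP := small_powerset (small_powerset sB').
apply: le_small sP; apply: card_le_injP.
exists (fun z => if pselect (B z) then [set [set b : B | set_val b = z]]
  else [set [set b : B | set_val b = f z]; set0]) => // x y ABx ABy.
have ne z : B z -> [set b : B | set_val b = z] <> set0.
  move=> Bz /seteqP[h _]; exact: (h (SigSub (mem_set Bz))).
have eqs z z' : B z -> [set b : B | set_val b = z] = [set b : B | set_val b = z'] -> z = z'.
  move=> Bz /seteqP[h _]; exact: (h (SigSub (mem_set Bz))).
have fBn z : ~ B z -> (A `|` B) z -> A z by move=> nB [].
case: pselect => Bx; case: pselect => By /seteqP[h1 h2].
- by apply: eqs => //; exact: (h1 _ erefl).
- by have /esym/(ne _ Bx) := h2 set0 (or_intror erefl).
- by have /esym/(ne _ By) := h1 set0 (or_intror erefl).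
- have Ax := fBn _ Bx ABx; have Ay := fBn _ By ABy; apply: finj => //.
  apply: eqs; first exact: fB.
  by have [//|/ne[]] := h1 _ (or_introl erefl); exact: fB.
Qed.

Lemma small_bigcup_ord {T : Type} n (F : 'I_n -> set T) :
  (forall i, small (F i)) -> small (\bigcup_i F i).
Proof.
elim: n F => [|n IH] F sF.
  suff -> : \bigcup_i F i = set0 by apply: small_finite.
  by apply/seteqP; split=> // x [[]].
apply: (@small_sub _ _ (F ord0 `|` \bigcup_i F (lift ord0 i))).
  move=> x [i _]; case: (unliftP ord0 i) => [k ->|->] h; last by left.
  by right; exists k.
by apply: smallU => //; apply: IH.
Qed.

Lemma small_range_copair (V : finType) (W T : Type) (a : V -> T) (c : W -> T) :
  small (range c) -> small (range (copair a c)).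
Proof.
move=> sc; apply: (@small_sub _ _ (range a `|` range c)).
  by move=> _ [[v|w] _ <-]; [left; exists v|right; exists w].
apply: smallU => //; apply: small_finite.
by apply: finite_image; exact: finite_finset.
Qed.
End Small.
(** * Saturation, homogeneity and coheirs for tuples *)

Lemma finite_sub_image {T U : Type} (f : T -> U) (S : set T) (F' : set U) :
  finite_set F' -> F' `<=` f @` S ->
  exists F, [/\ finite_set F, F `<=` S & F' `<=` f @` F].
Proof.
move: F'; apply: finite_set_ind => [_|y F' IH sub].
  by exists set0; split; [exact: finite_set0|exact: sub0set|].

have [F [Ffin FS F'F]] := IH (fun z F'z => sub z (or_intror F'z)).
have [x Sx fx] := sub y (or_introl erefl).
exists (x |` F); split.
- by rewrite finite_setU; split=> //; exact: finite_set1.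
- by move=> z [->|/FS].
- by move=> z [->|/F'F [t Ft <-]]; [exists x => //; left|exists t => //; right].
Qed.

Lemma automorphism_sat (L : language) (T : Type) (S : structure L T) sigma V
    (phi : formula L V) (v : V -> T) :
  automorphism S sigma -> sat S (sigma \o v) phi <-> sat S v phi.
Proof.
move=> [sbij sfun srel]; have [tau stK tsK] := sbij.
have evalE V' (v' : V' -> T) t : Defs.eval S (sigma \o v') t = sigma (Defs.eval S v' t).
  elim: t => [//|f ts IH] /=.
  by rewrite sfun; congr fun_int; apply/funext => i; exact: IH.
elim: phi v => {V} [V r ts|V s t|V|V p IHp q IHq|V p IHp] v /=.
- have -> : (fun i => Defs.eval S (sigma \o v) (ts i)) =
      sigma \o (fun i => Defs.eval S v (ts i)) by apply/funext => i; exact: evalE.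
  exact: iff_sym (srel _ _).
- by rewrite !evalE; split=> [/(can_inj stK)|->].
- by [].
- by rewrite IHp IHq.
- have e x : (fun o => if o is Some y then sigma (v y) else sigma x) =
      sigma \o (fun o => if o is Some y then v y else x).
    by apply/funext => -[].
  split=> h x; first by apply/IHp; rewrite -e; exact: h.
  by rewrite -[x]tsK e; apply/IHp.
Qed.

Section Monster.
Context {L : language} {M C K : Type} (SM : structure L M) (SC : structure L C).
Context (j : M -> C) (K_limit : strong_limit K) (C_monster : monster K SM SC j).

Lemma sat_elementary V (phi : formula L V) (v : V -> M) :
  sat SM v phi <-> sat SC (j \o v) phi.
Proof.
have [el _ _] := C_monster.
by have := el (rename phi v); rewrite !sat_rename.
Qed.

Lemma saturated1 W (c : W -> C) (Sigma : set (formula L (unit + W))) :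
  @small K _ (range c) -> fin_sat SC c Sigma ->
  exists a, forall phi, Sigma phi -> sat SC (copair a c) phi.
Proof.
move=> sc fs; have [_ sat_C _] := C_monster.
pose cls w : range c := SigSub (mem_set (imageT c w)).
pose rho (phi : formula L (unit + W)) := rename phi (copair inl (inr \o cls)).
have rhoE a phi : sat SC (copair a set_val) (rho phi) = sat SC (copair a c) phi.
  by rewrite sat_rename copair_comp; congr (sat SC (copair _ _) phi); apply/funext.
have [|a ha] := sat_C _ sc (rho @` Sigma).
  move=> F' F'fin /(finite_sub_image F'fin)[F [Ffin FS F'F]].
  have [a ha] := fs _ Ffin FS; exists a => _ /F'F[phi Fphi <-].
  by rewrite /solset /= rhoE; exact: ha.
by exists a => phi Sphi; rewrite -rhoE; apply: ha; exists phi.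
Qed.

(** The last n components are found first, by induction, as a realization of the
    formulas (exists x_0, conjunction of F), for F a finite part of Sigma; then
    x_0 is found over these components by one-variable saturation. *)
Lemma saturated_ord n W (c : W -> C) (Sigma : set (formula L ('I_n + W))) :
  @small K _ (range c) -> fin_sat SC c Sigma ->
  exists a, forall phi, Sigma phi -> sat SC (copair a c) phi.
Proof.
elim: n W c Sigma => [|n IH] W c Sigma sc fs.
  exists ord0_elim => phi Sphi; have [|a ha] := fs _ (finite_set1 phi); first by move=> _ ->.
  have -> : ord0_elim = a by apply/funext => -[].
  exact: ha.
pose rho (phi : formula L ('I_n.+1 + W)) : formula L (unit + ('I_n + W)) :=
  rename phi (copair
    (fun i => if unlift ord0 i is Some k then inr (inl k) else inl tt) (inr \o inr)).
pose cons x (a : 'I_n -> C) i := if unlift ord0 i is Some k then a k else x.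
have rhoE x a phi : sat SC (copair x (copair a c)) (rho phi) =
    sat SC (copair (cons (x tt) a) c) phi.
  rewrite sat_rename copair_comp; congr (sat SC (copair _ _) phi).
  by apply/funext => i /=; rewrite /cons; case: unlift.
(* the formulas equivalent to (exists x_0, conjunction of F) *)
pose Sigma1 : set (formula L ('I_n + W)) := [set psi | exists F,
  [/\ finite_set F, F `<=` Sigma & forall a, sat SC (copair a c) psi <->
     exists x, forall phi, F phi -> sat SC (copair (cons x a) c) phi]].
have [||a ha] := IH _ c Sigma1; first by [].
  move=> F1 F1fin F1S.
  have [F [Ffin FS hF]] : exists F, [/\ finite_set F, F `<=` Sigma & forall a,
      (exists x, forall phi, F phi -> sat SC (copair (cons x a) c) phi) ->
      forall psi, F1 psi -> sat SC (copair a c) psi].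
    move: F1 F1fin F1S; apply: finite_set_ind => [_|psi F1 IHF sub].
      by exists set0; split=> // a _ psi [].
    have [F [Ffin FS hF]] := IHF (fun z F'z => sub z (or_intror F'z)).
    have [F' [F'fin F'S hF']] := sub psi (or_introl erefl).
    exists (F `|` F'); split.
    - by rewrite finite_setU.
    - by move=> phi [/FS|/F'S].
    - move=> a [x hx] chi [->|F1chi].
        by apply/hF'; exists x => phi F'phi; apply: hx; right.
      by apply: hF F1chi; exists x => phi Fphi; apply: hx; left.
  have [a ha] := fs _ Ffin FS.
  exists (a \o lift ord0) => psi F1psi; apply: hF F1psi; exists (a ord0) => phi Fphi.
  have -> : cons (a ord0) (a \o lift ord0) = a.
    by apply/funext => i; rewrite /cons; case: unliftP => [k ->|->].
  exact: ha.
have [||x hx] := @saturated1 _ (copair a c) (rho @` Sigma).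
- exact: small_range_copair.
- move=> F' F'fin /(finite_sub_image F'fin)[F [Ffin FS F'F]].
  have [chi hchi] := finite_conj Ffin.
  have : Sigma1 (exf (rho chi)).
    exists F; split=> // b; rewrite sat_exf; split=> [[x]|[x hx]].
      by rewrite rhoE => /hchi hx; exists (x tt).
    by exists (fun=> x); rewrite rhoE; apply/hchi.
  move=> /ha; rewrite sat_exf => -[x]; rewrite rhoE => /hchi hx.
  by exists x => _ /F'F [phi Fphi <-]; rewrite /solset /= rhoE; exact: hx.
by exists (cons (x tt) a) => phi Sphi; rewrite -rhoE; apply: hx; exists phi.
Qed.

Lemma saturated_fin (V : finType) W (c : W -> C) (Sigma : set (formula L (V + W))) :
  @small K _ (range c) -> fin_sat SC c Sigma ->
  exists a, forall phi, Sigma phi -> sat SC (copair a c) phi.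
Proof.
move=> sc fs.
pose rho (phi : formula L (V + W)) : formula L ('I_#|V| + W) :=
  rename phi (copair (inl \o enum_rank) inr).
have rhoE a phi : sat SC (copair a c) (rho phi) = sat SC (copair (a \o enum_rank) c) phi.
  by rewrite sat_rename copair_comp.
have [|a ha] := @saturated_ord _ _ c (rho @` Sigma) sc.
  move=> F' F'fin /(finite_sub_image F'fin)[F [Ffin FS F'F]].
  have [a ha] := fs _ Ffin FS; exists (a \o enum_val) => _ /F'F[phi Fphi <-].
  rewrite /solset /= rhoE; have -> : (a \o enum_val) \o enum_rank = a.
    by apply/funext => v /=; rewrite enum_rankK.
  exact: ha.
by exists (a \o enum_rank) => phi Sphi; rewrite -rhoE; apply: ha; exists phi.
Qed.

(** Strong homogeneity for indexed families, repetitions allowed: equality of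
    entries is part of the type, so a w |-> b w is a well-defined map. *)
Lemma homogeneous_tuple W (a b : W -> C) : @small K _ (range a) ->
  (forall phi, sat SC a phi <-> sat SC b phi) ->
  exists2 sigma, automorphism SC sigma & forall w, sigma (a w) = b w.
Proof.
move=> sa ab; have [_ _ hom] := C_monster.
have /choice[s sP] (x : range a) : exists w, a w = set_val x.
  by have [w _ wE] := set_mem (valP x); exists w.
have [|sigma autS sE] := hom _ sa (b \o s).
  move=> phi; have := ab (rename phi s); rewrite !sat_rename.
  by have -> : a \o s = set_val by apply/funext.
exists sigma => // w; pose x : range a := SigSub (mem_set (imageT a w)).
have [/= h _] := ab (Eq (@Var L W (s x)) (@Var L W w)).
exact: etrans (sE x) (h (sP x)).
Qed.

(** An ultrafilter on tuples of the model defines a complete type over any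
    parameters c. This type is finitely satisfiable in the model, and invariant:
    the right-hand side depends on c only through its type over the model. *)
Lemma coheir_realized (V : finType) (U : set_system (V -> M)) W (c : W -> C) :
  UltraFilter U -> @small K _ (range c) ->
  exists a, forall phi,
    sat SC (copair a c) phi <-> U [set t | sat SC (copair (j \o t) c) phi].
Proof.
move=> Uultra sc.
have [a ha] : exists a, forall phi, U [set t | sat SC (copair (j \o t) c) phi] ->
    sat SC (copair a c) phi.
  apply: (saturated_fin sc) => F Ffin FS; have [chi hchi] := finite_conj Ffin.
  have : U [set t | sat SC (copair (j \o t) c) chi].
    have -> : [set t | sat SC (copair (j \o t) c) chi] =
        [set t | forall phi, F phi -> sat SC (copair (j \o t) c) phi].
      by apply/seteqP; split=> t /=; move/hchi.
    move: F Ffin FS {chi hchi}; apply: finite_set_ind => [_|phi F IH sub].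
      by apply: filterS filterT => t _ phi [].
    have UF := IH (fun z Fz => sub z (or_intror Fz)).
    have Uphi := sub phi (or_introl erefl).
    by apply: filterS (filterI UF Uphi) => t [h1 h2] psi [->//|/h1].
  by move=> /filter_ex[t ht]; exists (j \o t); apply/hchi.
exists a => phi; split=> [h|]; last exact: ha.
have [//|nU] := in_ultra_setVsetC [set t | sat SC (copair (j \o t) c) phi] Uultra.
by case: (ha (fnot phi) nU h).
Qed.

End Monster.
(** * Cosets of bounded index subgroups and types over the model *)

Lemma theP {T : Type} (x0 : T) (P : set T) : (exists x, P x) -> P (the x0 P).
Proof. by move=> ex; rewrite /the; case: pselect => // e; exact: projT2 (cid e). Qed.

Section GroupOnSet.
Context {X : Type} (Gs : set X) (op : X -> X -> X) (e : X).

(** The law is only a group law on the subset Gs, which is why a group structure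
    on the ambient type cannot be used. *)
Record group_on : Prop := GroupOn {
  group_on1 : Gs e;
  group_onM : forall a b, Gs a -> Gs b -> Gs (op a b);
  group_onA : forall a b c, Gs a -> Gs b -> Gs c -> op a (op b c) = op (op a b) c;
  group_on1l : forall a, Gs a -> op e a = a;
  group_on1r : forall a, Gs a -> op a e = a;
  group_onV : forall a, Gs a -> exists2 b, Gs b & op a b = e /\ op b a = e }.

Definition subgroup_on (H : set X) : Prop :=
  [/\ H `<=` Gs, H e, forall a b, H a -> H b -> H (op a b)
    & forall a, H a -> exists2 b, H b & op a b = e].

Definition same_left_coset (H : set X) (a b : X) := exists2 h, H h & b = op a h.

Context (grp : group_on).

Lemma group_on_rinv_linv a b : Gs a -> Gs b -> op a b = e -> op b a = e.
Proof.
move=> Ga Gb ab; have [c Gc [ac ca]] := group_onV grp Ga.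
suff -> : b = c by [].
rewrite -(group_on1l grp Gb) -ca -(group_onA grp Gc Ga Gb) ab.
by rewrite (group_on1r grp Gc).
Qed.

Lemma group_on_subgroup : subgroup_on Gs.
Proof.
split=> //; first exact: group_on1 grp; first exact: group_onM grp.
by move=> a /(group_onV grp)[b Gb [ab _]]; exists b.
Qed.

Section Cosets.
Context (H : set X) (subH : subgroup_on H).

Lemma same_left_coset_sym a b :
  Gs a -> same_left_coset H a b -> same_left_coset H b a.
Proof.
case: subH => HG He HM HV Ga [h Hh ->]; have [h' Hh' hh'] := HV _ Hh.
exists h' => //; rewrite -(group_onA grp) ?hh' ?(group_on1r grp) //; exact: HG.
Qed.

Lemma same_left_coset_trans a b c : Gs a ->
  same_left_coset H a b -> same_left_coset H b c -> same_left_coset H a c.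
Proof.
case: subH => HG He HM HV Ga [h Hh ->] [h' Hh' ->].
exists (op h h'); first exact: HM.
by rewrite (group_onA grp) //; exact: HG.
Qed.

Lemma same_left_cosetP a b : Gs a -> Gs b ->
  op a @` H = op b @` H <-> same_left_coset H a b.
Proof.
move=> Ga Gb; split=> [E|ab].
  have [h Hh <-] : (op a @` H) b; last by exists h.
  by rewrite E; case: subH => _ He _ _; exists e; rewrite ?(group_on1r grp).
have sub c d : Gs c -> Gs d -> same_left_coset H c d -> op d @` H `<=` op c @` H.
  move=> Gc Gd cd _ [h Hh <-].
  have [k Hk ->] : same_left_coset H c (op d h); last by exists k.
  by apply: same_left_coset_trans cd _ => //; exists h.
by apply/seteqP; split; apply: sub => //; exact: same_left_coset_sym.
Qed.

End Cosets.
End GroupOnSet.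

Section TypesAndCosets.
Context {L : language} {M C K : Type} (SM : structure L M) (SC : structure L C).
Context (j : M -> C) (K_limit : strong_limit K) (C_monster : monster K SM SC j).
Context (smallM : @small K _ (range j)) {n : nat}.
Context (Gs : set ('I_n -> C)) (op : ('I_n -> C) -> ('I_n -> C) -> 'I_n -> C).
Context (e : 'I_n -> C) (grp : group_on Gs op e).
Context (delta : formula L ('I_n + M)) (gamma : formula L ('I_n + 'I_n + 'I_n + M)).
Context (deltaE : forall a, Gs a <-> sat SC (copair a j) delta).
Context (gammaE : forall a b c, Gs a -> Gs b ->
  c = op a b <-> sat SC (copair (copair (copair a b) c) j) gamma).

Definition same_type (a b : 'I_n -> C) :=
  forall phi : formula L ('I_n + M),
    sat SC (copair a j) phi <-> sat SC (copair b j) phi.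

Lemma same_type_Gs a b : same_type a b -> Gs a -> Gs b.
Proof. by move=> ab /deltaE /ab /deltaE. Qed.

Lemma automorphism_op sigma a b :
  automorphism SC sigma -> (forall m, sigma (j m) = j m) -> Gs a -> Gs b ->
  sigma \o op a b = op (sigma \o a) (sigma \o b).
Proof.
move=> autS fixM; have fixj : sigma \o j = j by apply/funext.
have sG c : Gs c -> Gs (sigma \o c).
  by move=> /deltaE /(automorphism_sat _ _ autS); rewrite copair_comp fixj => /deltaE.
move=> Ga Gb; apply/gammaE; [exact: sG|exact: sG|].
rewrite -!copair_comp -fixj -copair_comp; apply/automorphism_sat => //.
exact/gammaE.
Qed.

(** The formulas true at x define a filter base on tuples of the model, because
    the model is elementary; any ultrafilter containing it is a coheir of the
    type of x. *)
Lemma same_type_coheir x : exists2 U : set_system ('I_n -> M), UltraFilter U &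
  forall phi, sat SC (copair x j) phi -> U [set t | sat SM (copair t id) phi].
Proof.
pose p : set (formula L ('I_n + M)) := [set phi | sat SC (copair x j) phi].
pose B (phi : formula L ('I_n + M)) := [set t | sat SM (copair t id) phi].
have FF : Filter (filter_from p B).
  apply: filter_from_filter; first by exists ftrue.
  move=> phi psi pphi ppsi; exists (fand phi psi).
    by rewrite -[p _]/(sat SC (copair x j) (fand phi psi)) sat_fand.
  by move=> t; rewrite -[B _ t]/(sat SM (copair t id) (fand phi psi)) sat_fand.
have PF : ProperFilter (filter_from p B).
  apply: filter_from_proper => phi pphi.
  suff : sat SM id (exf phi) by rewrite sat_exf => -[t ht]; exists t.
  have [el _ _] := C_monster; apply/el; rewrite sat_exf; exists x; exact: pphi.
have [U [Uultra FU]] := ultraFilterLemma PF.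
by exists U => // phi pphi; apply: FU; exists phi.
Qed.

(** A realization a0 of the coheir over enough parameters lies in the coset of a
    representative r with the type of x. Since the coheir is invariant, (a0, r),
    (a0, x) and (a0, y) have the same type over the model, and the invariance of
    H carries the relation between r and a0 over to x and y. *)
Lemma same_type_same_coset H :
  subgroup_on Gs op e H -> card_lt [set op a @` H | a in Gs] [set: K] ->
  (forall sigma, automorphism SC sigma -> (forall m, sigma (j m) = j m) ->
    forall a, H a -> H (sigma \o a)) ->
  forall x y, Gs x -> same_type x y -> same_left_coset op H x y.
Proof.
move=> subH bound inv x y Gx xy.
have [U Uultra Ux] := same_type_coheir x.
(* a representative of Y with the type of x, if there is one, and x otherwise *)
pose rep Y := the x [set r | same_type x r /\ op r @` H = Y].
have repx Y : same_type x (rep Y).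
  by rewrite /rep /the; case: pselect => // r; case: (projT2 (cid r)).
pose R0 := rep @` [set op a @` H | a in Gs] `|` [set x; y].
have R0x z : R0 z -> same_type x z.
  by move=> [[Y _ <-]|[->|->]] //; exact: repx.
pose c : M + R0 * 'I_n -> C := copair j (fun zi => set_val zi.1 zi.2).
have smallc : @small K _ (range c).
  apply: (@small_sub K _ _ (range j `|` \bigcup_i ((fun z => z i) @` R0))).
    move=> _ [[m|[z i]] _ <-]; first by left; exists m.
    by right; exists i => //; exists (set_val z) => //; exact: set_mem (valP z).
  apply: smallU => //; apply: small_bigcup_ord => // i; apply: small_image.
  apply: smallU => //; first exact: small_image.
  by apply: small_finite => //; exact: finite_set2.
have [a0 a0P] := coheir_realized K_limit C_monster Uultra smallc.
have xa0 : same_type x a0.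
  have sub phi : sat SC (copair x j) phi -> sat SC (copair a0 j) phi.
    pose psi : formula L ('I_n + (M + R0 * 'I_n)) := rename phi (copair inl (inr \o inl)).
    have psiE t : sat SC (copair t c) psi = sat SC (copair t j) phi.
      by rewrite sat_rename copair_comp.
    move=> /Ux Uphi; rewrite -psiE a0P.
    apply: filterS Uphi => t /= /(sat_elementary C_monster).
    by rewrite psiE copair_comp.
  move=> phi; split; first exact: sub.
  by move=> h; apply: contrapT => /(sub (fnot phi)) /(_ h).
(* invariance of the coheir *)
have a0R z : R0 z -> forall phi, sat SC (copair a0 (copair z j)) phi <->
    U [set t | sat SC (copair (j \o t) (copair x j)) phi].
  move=> R0z phi; pose Z : R0 := SigSub (mem_set R0z).
  pose psi : formula L ('I_n + (M + R0 * 'I_n)) :=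
    rename phi (copair inl (copair (fun i => inr (inr (Z, i))) (inr \o inl))).
  have psiE t : sat SC (copair t c) psi = sat SC (copair t (copair z j)) phi.
    by rewrite sat_rename !copair_comp.
  rewrite -psiE a0P.
  suff -> : [set t | sat SC (copair (j \o t) c) psi] =
    [set t | sat SC (copair (j \o t) (copair x j)) phi] by [].
  apply/funext => t /=; apply/propext; rewrite psiE.
  have := R0x _ R0z (rename phi (copair (inr \o t) (copair inl inr))).
  by rewrite !sat_rename !copair_comp => h; apply: iff_sym.
have move_coset z z' : R0 z -> R0 z' ->
    same_left_coset op H z a0 -> same_left_coset op H z' a0.
  move=> R0z R0z' [h Hh a0E].
  have [||sigma autS sE] := @homogeneous_tuple _ _ _ _ _ _ _ C_monster _
     (copair a0 (copair z j)) (copair a0 (copair z' j)).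
  - by do 2![apply: small_range_copair => //].
  - by move=> phi; rewrite (a0R z) // (a0R z').
  have fixM m : sigma (j m) = j m := sE (inr (inr m)).
  exists (sigma \o h); first exact: inv.
  have <- : sigma \o z = z' by apply/funext => i; exact: sE (inr (inl i)).
  have Gz := same_type_Gs (R0x _ R0z) Gx.
  have Gh : Gs h by case: subH => HG _ _ _; exact: HG.
  rewrite -automorphism_op // -a0E.
  by apply/funext => i; exact: esym (sE (inl i)).
have Ga0 := same_type_Gs xa0 Gx; have Gy := same_type_Gs xy Gx.
have R0rep : R0 (rep (op a0 @` H)) by left; exists (op a0 @` H) => //; exists a0.
have rep_a0 : same_left_coset op H (rep (op a0 @` H)) a0.
  apply/(same_left_cosetP grp subH) => //; first exact: same_type_Gs (R0x _ R0rep) Gx.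
  have [] // : same_type x (rep (op a0 @` H)) /\ op (rep (op a0 @` H)) @` H = op a0 @` H.
  by apply: (@theP _ x [set r | same_type x r /\ _]); exists a0.
have xa0' := move_coset _ _ R0rep (or_intror (or_introl erefl)) rep_a0.
have ya0' := move_coset _ _ R0rep (or_intror (or_intror erefl)) rep_a0.
apply: (same_left_coset_trans grp subH) xa0' _ => //.
exact: (same_left_coset_sym grp subH).
Qed.

(** The inverses of x and y again have the same type, and right cosets correspond
    to left cosets by inversion. *)
Lemma same_type_same_right_coset H :
  subgroup_on Gs op e H -> card_lt [set op a @` H | a in Gs] [set: K] ->
  (forall sigma, automorphism SC sigma -> (forall m, sigma (j m) = j m) ->
    forall a, H a -> H (sigma \o a)) ->
  (forall sigma, automorphism SC sigma -> (forall m, sigma (j m) = j m) ->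
    sigma \o e = e) ->
  forall x y, Gs x -> same_type x y -> exists2 h, H h & x = op h y.
Proof.
move=> subH bound inv fix_e x y Gx xy; have Gy := same_type_Gs xy Gx.
have [x' Gx' [xx' x'x]] := group_onV grp Gx.
have [||sigma autS sE] := @homogeneous_tuple _ _ _ _ _ _ _ C_monster _
     (copair x j) (copair y j).
- exact: small_range_copair.
- exact: xy.
have fixM m : sigma (j m) = j m := sE (inr m).
have fixj : sigma \o j = j by apply/funext.
have sx : sigma \o x = y by apply/funext => i; exact: sE (inl i).
pose y' := sigma \o x'.
have xy' : same_type x' y'.
  by move=> phi; rewrite -(automorphism_sat phi (copair x' j) autS) copair_comp fixj.
have yy' : op y y' = e by rewrite /y' -sx -automorphism_op // xx' fix_e.
have Gy' := same_type_Gs xy' Gx'.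
have [h Hh y'E] := same_type_same_coset subH bound inv Gx' xy'.
have Gh : Gs h by case: subH => HG _ _ _; exact: HG.
exists h => //.
have -> : h = op x y' by rewrite y'E (group_onA grp) // xx' (group_on1l grp).
rewrite -(group_onA grp) // (group_on_rinv_linv grp _ _ yy') //.
by rewrite (group_on1r grp).
Qed.

End TypesAndCosets.

(** A coset is determined by the type of a representative, and a type is a set of
    formulas. Variables indexed by nat are used for the components of the
    n-tuple; the components from n on are given the value of some m0 in the
    model, which carries no information. *)
Lemma types_bound_index (L : language) (M C K : Type) (SC : structure L C)
    (j : M -> C) (n : nat) (Gs : set ('I_n -> C)) op e H :
  strong_limit K -> inhabited M ->
  @small K _ [set: formula L (nat + M)] ->
  group_on Gs op e -> subgroup_on Gs op e H ->
  (forall x y, Gs x -> Gs y -> same_type SC j x y -> same_left_coset op H x y) ->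
  card_lt [set op a @` H | a in Gs] [set: K].
Proof.
move=> K_limit [m0] K_large grp subH HT.
pose ext (a : 'I_n -> C) (k : nat) := if insub k is Some i then a i else j m0.
pose tp a : set (formula L (nat + M)) := [set phi | sat SC (copair (ext a) j) phi].
have tpP a b : tp a = tp b -> same_type SC j a b.
  move=> E phi.
  have tpE c : tp c (rename phi (copair (inl \o val) inr)) = sat SC (copair c j) phi.
    rewrite /tp /mkset sat_rename copair_comp; congr (sat SC (copair _ _) phi).
    by apply/funext => i; rewrite /ext /= valK.
  by rewrite -!tpE E.
pose rep Y := the e [set a | Gs a /\ op a @` H = Y].
have repP Y : [set op a @` H | a in Gs] Y -> Gs (rep Y) /\ op (rep Y) @` H = Y.
  move=> [a Ga aY]; apply: (@theP _ e [set a | Gs a /\ op a @` H = Y]).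
  by exists a.
apply: le_small (small_powerset K_limit K_large); apply: card_le_injP.
exists (fun Y => tp (rep Y)) => // Y Z /repP[GY EY] /repP[GZ EZ] /tpP E.
by rewrite -EY -EZ; apply/(same_left_cosetP grp subH) => //; exact: HT.
Qed.
(** * The group law on the nonstandard extension *)

Lemma sat_transfer_all (L : language) (M C K : Type) (SM : structure L M)
    (SC : structure L C) (j : M -> C) (V : finType) (phi : formula L (V + M)) :
  monster K SM SC j ->
  (forall v, sat SM (copair v id) phi) <-> (forall v, sat SC (copair v j) phi).
Proof.
by case=> el _ _; have := el (allf phi); rewrite !sat_allf.
Qed.

Lemma smallest_of_bigcap {T : Type} (P : set (set T)) :
  P (\bigcap_(H in P) H) -> smallest_of P = \bigcap_(H in P) H.
Proof.
move=> PI; have [] := @theP _ set0 [set H | P H /\ forall H', P H' -> H `<=` H'].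
  by exists (\bigcap_(H in P) H); split=> // H' PH' x; exact.
rewrite -/(smallest_of P) => PS Smin; apply/seteqP; split; last exact: bigcap_inf PS.
by move=> x Sx H PH; exact: Smin Sx.
Qed.

Section Extension.
Context {L E : language} {M C K : Type}.
Context (SM : structure (lang_sum L E) M) (SC : structure (lang_sum L E) C).
Context (j : M -> C) (n : nat) (G : topologicalGroupType) (iota : G -> 'I_n -> M).
Context (C_monster' : monster K SM SC j).

Lemma star_solset (V : finType) (phi : formula (lang_sum L E) (V + M)) D :
  solset SM id phi = D -> star SM SC j D = solset SC j phi.
Proof.
move=> phiD; apply/seteqP; split=> a; last by exists phi.
move=> [psi psiD psia].
have /(sat_transfer_all _ C_monster') h : forall v, sat SM (copair v id) (Imp psi phi).
  move=> v psiv; have : solset SM id psi v by [].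
  by rewrite psiD -phiD.
exact: h psia.
Qed.

Lemma star_emb (V : finType) (phi : formula (lang_sum L E) (V + M)) D a :
  solset SM id phi = D -> D a -> star SM SC j D (j \o a).
Proof.
move=> phiD; rewrite (star_solset phiD) -phiD => /(sat_elementary C_monster').
by rewrite copair_comp.
Qed.

Lemma star_invariant (V : Type) (D : set (V -> M)) sigma a :
  automorphism SC sigma -> (forall m, sigma (j m) = j m) ->
  star SM SC j D a -> star SM SC j D (sigma \o a).
Proof.
move=> autS fixM [phi phiD phia]; exists phi => //.
have fixj : sigma \o j = j by apply/funext.
by move: phia => /(automorphism_sat _ _ autS); rewrite copair_comp fixj.
Qed.

Lemma mul_graphE a b c : mul_graph iota (copair (copair a b) c) <->
  exists g h, [/\ a = iota g, b = iota h & c = iota (g * h)%g].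
Proof.
split=> [[g [h e]]|[g [h [-> -> ->]]]]; exists g, h => //.
have ef x : copair (copair a b) c x = _ := congr1 (@^~ x) e.
split; apply/funext => i; [exact: (ef (inl (inl i)))|exact: (ef (inl (inr i)))|].
exact: (ef (inr i)).
Qed.

Context (iota_inj : injective iota).
Context (delta : formula (lang_sum L E) ('I_n + M)).
Context (gamma : formula (lang_sum L E) ('I_n + 'I_n + 'I_n + M)).
Context (deltaM : solset SM id delta = range iota).
Context (gammaM : solset SM id gamma = mul_graph iota).

Local Notation Gs := (Gstar SM SC j iota).
Local Notation op := (smul SM SC j iota).
Local Notation e := (embG j iota 1%g).

Definition star_mul (a b c : 'I_n -> C) :=
  star SM SC j (mul_graph iota) (copair (copair a b) c).

(** The atomic statements about multiplication and about membership in G, at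
    positions given by functions into variables and parameters; the group axioms
    are transferred from M to C as sentences built from them. *)
Definition graph_at {V} (p q r : 'I_n -> V + M) :=
  rename gamma (copair (copair (copair p q) r) inr).
Definition domain_at {V} (p : 'I_n -> V + M) := rename delta (copair p inr).

Lemma graph_atM V (v : V -> M) p q r : let w := copair v id in
  sat SM w (graph_at p q r) <->
  exists g h, [/\ w \o p = iota g, w \o q = iota h & w \o r = iota (g * h)%g].
Proof.
move=> w; rewrite -mul_graphE -gammaM /graph_at sat_rename !copair_comp.
by rewrite /solset.
Qed.

Lemma graph_atC V (v : V -> C) p q r : let w := copair v j in
  sat SC w (graph_at p q r) = star_mul (w \o p) (w \o q) (w \o r).
Proof.
move=> w; rewrite /star_mul (star_solset gammaM).
by rewrite /graph_at sat_rename !copair_comp.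
Qed.

Lemma domain_atM V (v : V -> M) p : let w := copair v id in
  sat SM w (domain_at p) <-> exists g, w \o p = iota g.
Proof.
move=> w; have -> : (exists g, w \o p = iota g) <-> range iota (w \o p).
  by split=> [[g ->]|[g _ <-]]; exists g.
by rewrite -deltaM /domain_at sat_rename copair_comp.
Qed.

Lemma domain_atC V (v : V -> C) p : let w := copair v j in
  sat SC w (domain_at p) = Gs (w \o p).
Proof.
move=> w; rewrite /Gstar (star_solset deltaM).
by rewrite /domain_at sat_rename copair_comp.
Qed.

Lemma star_mul_domain a b c : star_mul a b c -> [/\ Gs a, Gs b & Gs c].
Proof.
pose V : finType := ('I_n + ('I_n + 'I_n))%type.
pose pa : 'I_n -> V + M := inl \o inl.
pose pb : 'I_n -> V + M := inl \o (inr \o inl).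
pose pc : 'I_n -> V + M := inl \o (inr \o inr).
have /(sat_transfer_all _ C_monster') /(_ (copair a (copair b c))) : forall v,
    sat SM (copair v id) (Imp (graph_at pa pb pc)
      (fand (domain_at pa) (fand (domain_at pb) (domain_at pc)))).
  move=> v; rewrite sat_imp => /graph_atM[g [h [ag bh cgh]]]; rewrite !sat_fand !domain_atM.
  by split; [exists g|split; [exists h|exists (g * h)%g]].
by rewrite sat_imp !sat_fand graph_atC !domain_atC => h /h [? []].
Qed.


Lemma star_mul_total a b : Gs a -> Gs b -> exists c, star_mul a b c.
Proof.
pose V : finType := ('I_n + 'I_n)%type.
pose pa : 'I_n -> 'I_n + (V + M) := inr \o (inl \o inl).
pose pb : 'I_n -> 'I_n + (V + M) := inr \o (inl \o inr).
pose rho : 'I_n + (V + M) -> ('I_n + V) + M :=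
  copair (inl \o inl) (copair (inl \o inr) inr).
have /(sat_transfer_all _ C_monster') /(_ (copair a b)) : forall v,
    sat SM (copair v id) (Imp (domain_at (inl \o inl)) (Imp (domain_at (inl \o inr))
      (exf (rename (graph_at (inl \o inr \o inl) (inl \o inr \o inr) (inl \o inl))
        (copair (copair inl (inr \o inl)) (inr \o inr)))))).
  move=> v; rewrite !sat_imp => /domain_atM[g ag] /domain_atM[h bh].
  rewrite sat_exf; exists (iota (g * h)%g); rewrite sat_rename !copair_comp.
  by apply/graph_atM; exists g, h.
rewrite !sat_imp !domain_atC sat_exf => h /h{h} h /h{h} [c].
rewrite sat_rename !copair_comp graph_atC; by exists c.
Qed.


Lemma star_mul_functional a b c c' : star_mul a b c -> star_mul a b c' -> c = c'.
Proof.
pose V : finType := ('I_n + ('I_n + ('I_n + 'I_n)))%type.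
pose pa : 'I_n -> V + M := inl \o inl.
pose pb : 'I_n -> V + M := inl \o (inr \o inl).
pose pc : 'I_n -> V + M := inl \o (inr \o (inr \o inl)).
pose pd : 'I_n -> V + M := inl \o (inr \o (inr \o inr)).
move=> abc abc'; apply/funext => i.
have /(sat_transfer_all _ C_monster') : forall v,
    sat SM (copair v id) (Imp (graph_at pa pb pc) (Imp (graph_at pa pb pd)
      (Eq (@Var (lang_sum L E) _ (pc i)) (@Var (lang_sum L E) _ (pd i))))).
  move=> v; rewrite !sat_imp => /graph_atM[g [h [ag bh cgh]]].
  move=> /graph_atM[g' [h' [ag' bh' dgh]]].
  change ((copair v id \o pc) i = (copair v id \o pd) i); rewrite cgh dgh.
  have -> : g = g' by apply: iota_inj; rewrite -ag.
  by have -> : h = h' by apply: iota_inj; rewrite -bh.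
move=> /(_ (copair a (copair b (copair c c')))).
by rewrite !sat_imp !graph_atC => /(_ abc abc').
Qed.

Lemma star_mul_assoc a b c d f g : star_mul a b d -> star_mul d c f ->
  star_mul b c g -> star_mul a g f.
Proof.
pose V : finType := ('I_n + ('I_n + ('I_n + ('I_n + ('I_n + 'I_n)))))%type.
pose pa : 'I_n -> V + M := inl \o inl.
pose pb : 'I_n -> V + M := inl \o (inr \o inl).
pose pc : 'I_n -> V + M := inl \o (inr \o (inr \o inl)).
pose pd : 'I_n -> V + M := inl \o (inr \o (inr \o (inr \o inl))).
pose pf : 'I_n -> V + M := inl \o (inr \o (inr \o (inr \o (inr \o inl)))).
pose pg : 'I_n -> V + M := inl \o (inr \o (inr \o (inr \o (inr \o inr)))).
have /(sat_transfer_all _ C_monster') : forall v,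
    sat SM (copair v id) (Imp (graph_at pa pb pd) (Imp (graph_at pd pc pf)
      (Imp (graph_at pb pc pg) (graph_at pa pg pf)))).
  move=> v; rewrite !sat_imp => /graph_atM[x [y [ax byy dxy]]].
  move=> /graph_atM[x' [z [dx' cz fxz]]] /graph_atM[y' [z' [by' cz' gyz]]].
  have exy : x' = (x * y)%g by apply: iota_inj; rewrite -dx'.
  have ey : y' = y by apply: iota_inj; rewrite -by'.
  have ez : z' = z by apply: iota_inj; rewrite -cz'.
  by apply/graph_atM; exists x, (y * z)%g; rewrite ax fxz gyz exy ey ez mulgA.
move=> /(_ (copair a (copair b (copair c (copair d (copair f g)))))).
by rewrite !sat_imp !graph_atC.
Qed.

Lemma star_mul_id a : Gs a -> star_mul e a a /\ star_mul a e a.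
Proof.
pose pe : 'I_n -> 'I_n + M := inr \o iota 1%g.
have /(sat_transfer_all _ C_monster') /(_ a) : forall v,
    sat SM (copair v id) (Imp (domain_at inl)
      (fand (graph_at pe inl inl) (graph_at inl pe inl))).
  move=> v; rewrite sat_imp sat_fand => /domain_atM[g ag].
  rewrite !graph_atM; split.
    by exists 1%g, g; rewrite mul1g.
  by exists g, 1%g; rewrite mulg1.
by rewrite sat_imp sat_fand !graph_atC domain_atC; apply.
Qed.

Lemma star_mul_inv a : Gs a -> exists b, star_mul a b e /\ star_mul b a e.
Proof.
pose V : finType := ('I_n + 'I_n)%type.
pose pa : 'I_n -> V + M := inl \o inr.
pose pb : 'I_n -> V + M := inl \o inl.
pose pe : 'I_n -> V + M := inr \o iota 1%g.
have /(sat_transfer_all _ C_monster') /(_ a) : forall v,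
    sat SM (copair v id) (Imp (domain_at inl)
      (exf (rename (fand (graph_at pa pb pe) (graph_at pb pa pe))
        (copair (copair inl (inr \o inl)) (inr \o inr))))).
  move=> v; rewrite !sat_imp sat_exf => /domain_atM[g ag].
  exists (iota g^-1%g); rewrite sat_rename !copair_comp sat_fand !graph_atM.
  split; first by exists g, g^-1%g; rewrite mulgV.
  by exists g^-1%g, g; rewrite mulVg.
rewrite !sat_imp domain_atC sat_exf => h /h{h} [b].
rewrite sat_rename !copair_comp sat_fand !graph_atC; by exists b.
Qed.

Lemma smulP a b : Gs a -> Gs b -> star_mul a b (op a b).
Proof.
move=> Ga Gb; have [c abc] := star_mul_total Ga Gb.
by apply: (@theP _ a [set c | star_mul a b c]); exists c.
Qed.

Lemma star_mulP a b c : Gs a -> Gs b -> c = op a b <-> star_mul a b c.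
Proof.
move=> Ga Gb; split=> [->|abc]; first exact: smulP.
exact: star_mul_functional abc (smulP Ga Gb).
Qed.

Lemma Gstar_embG g : Gs (embG j iota g).
Proof. by apply: star_emb deltaM _; exists g. Qed.

Lemma star_mul_embG g h :
  star_mul (embG j iota g) (embG j iota h) (embG j iota (g * h)%g).
Proof.
have := @star_emb _ _ _ (copair (copair (iota g) (iota h)) (iota (g * h)%g)) gammaM.
by rewrite !copair_comp; apply; exists g, h.
Qed.

Lemma Gstar_group : group_on Gs op e.
Proof.
split.
- exact: Gstar_embG.
- by move=> a b Ga Gb; have [] := star_mul_domain (smulP Ga Gb).
- move=> a b c Ga Gb Gc.
  have [_ _ Gab] := star_mul_domain (smulP Ga Gb).
  have [_ _ Gbc] := star_mul_domain (smulP Gb Gc).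
  apply/esym/star_mulP => //.
  exact: star_mul_assoc (smulP Ga Gb) (smulP Gab Gc) (smulP Gb Gc).
- move=> a Ga; apply/esym/star_mulP => //; first exact: Gstar_embG.
  exact: (star_mul_id Ga).1.
- move=> a Ga; apply/esym/star_mulP => //; first exact: Gstar_embG.
  exact: (star_mul_id Ga).2.
- move=> a Ga; have [b [ab ba]] := star_mul_inv Ga.
  have [_ Gb _] := star_mul_domain ab; exists b => //.
  by split; apply/esym/star_mulP.
Qed.


(** * Factorization in the nonstandard extension *)

Definition directed (Theta : set (formula (lang_sum L E) ('I_n + M))) :=
  (exists theta, Theta theta) /\
  forall theta theta', Theta theta -> Theta theta' -> exists2 theta'', Theta theta'' &
    forall a, sat SC (copair a j) theta'' ->
      sat SC (copair a j) theta /\ sat SC (copair a j) theta'.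

Definition realizes (Theta : set (formula (lang_sum L E) ('I_n + M))) a :=
  forall theta, Theta theta -> sat SC (copair a j) theta.

(** For fixed theta and phi, solvability of (c y = t = m x, theta(m), phi(x),
    phi(y)) is a first-order property of c with parameters in M. It holds at the
    points of G, hence on all of Gstar; directedness and saturation yield a
    solution for all theta and phi at once. *)
Lemma Gstar_factor Theta Phi : strong_limit K -> @small K _ (range j) ->
  directed Theta -> directed Phi ->
  (forall g theta phi, Theta theta -> Phi phi -> exists m x y t,
    [/\ sat SC (copair m j) theta, sat SC (copair x j) phi, sat SC (copair y j) phi,
        star_mul (embG j iota g) y t & star_mul m x t]) ->
  forall c, Gs c -> exists m x y t, [/\ realizes Theta m, realizes Phi x,
    realizes Phi y, star_mul c y t & star_mul m x t].
Proof.
move=> K_limit smallM [[theta0 T0] dirT] [[phi0 P0] dirP] dense c Gc.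
pose V : finType := ('I_n + ('I_n + ('I_n + 'I_n)))%type.
pose pm : 'I_n -> (V + 'I_n) + M := inl \o (inl \o inl).
pose px : 'I_n -> (V + 'I_n) + M := inl \o (inl \o (inr \o inl)).
pose py : 'I_n -> (V + 'I_n) + M := inl \o (inl \o (inr \o (inr \o inl))).
pose pt : 'I_n -> (V + 'I_n) + M := inl \o (inl \o (inr \o (inr \o inr))).
pose pc : 'I_n -> (V + 'I_n) + M := inl \o inr.
pose at_var (p : 'I_n -> (V + 'I_n) + M) theta : formula (lang_sum L E) _ :=
  rename theta (copair p inr).
pose chi theta phi : formula (lang_sum L E) (V + ('I_n + M)) := rename
  (fand (at_var pm theta) (fand (at_var px phi) (fand (at_var py phi)
     (fand (graph_at pc py pt) (graph_at pm px pt)))))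
  (copair (copair inl (inr \o inl)) (inr \o inr)).
have chiE theta phi m x y t d :
    sat SC (copair (copair m (copair x (copair y t))) (copair d j)) (chi theta phi) <->
    [/\ sat SC (copair m j) theta, sat SC (copair x j) phi, sat SC (copair y j) phi,
        star_mul d y t & star_mul m x t].
  rewrite sat_rename !copair_comp !sat_fand !graph_atC !sat_rename !copair_comp.
  by split=> [[? [? [? []]]]|[]].
have etaV (v : V -> C) : exists m x y t, v = copair m (copair x (copair y t)).
  exists (v \o inl), (v \o (inr \o inl)), (v \o (inr \o (inr \o inl))),
    (v \o (inr \o (inr \o inr))).
  by apply/funext => -[|[|[]]].
have sat_chi theta phi : Theta theta -> Phi phi ->
    sat SC (copair c j) (exf (chi theta phi)).
  move=> Ttheta Pphi.
  have /(sat_transfer_all _ C_monster') /(_ c) : forall v,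
      sat SM (copair v id) (Imp (domain_at inl) (exf (chi theta phi))).
    move=> v; rewrite sat_imp => /domain_atM[g vg].
    apply/(sat_elementary C_monster'); rewrite copair_comp sat_exf.
    have [m [x [y [t mxyt]]]] := dense g _ _ Ttheta Pphi.
    exists (copair m (copair x (copair y t))).
    by rewrite (vg : v = iota g); apply/chiE.
  by rewrite sat_imp domain_atC; apply.
pose Sigma : set (formula (lang_sum L E) (V + ('I_n + M))) :=
  [set chi tp.1 tp.2 | tp in Theta `*` Phi].
have [||v hv] := @saturated_fin _ _ _ K SM SC j K_limit C_monster' V _ (copair c j) Sigma.
- exact: small_range_copair.
- move=> F Ffin FS.
  suff [theta [phi [Ttheta Pphi hF]]] : exists theta phi, [/\ Theta theta, Phi phi &
      forall v, sat SC (copair v (copair c j)) (chi theta phi) ->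
        forall psi, F psi -> sat SC (copair v (copair c j)) psi].
    by have := sat_chi _ _ Ttheta Pphi; rewrite sat_exf => -[v /hF]; exists v.
  move: F Ffin FS; apply: finite_set_ind => [_|psi F IH sub].
    by exists theta0, phi0; split=> // v _ psi [].
  have [theta [phi [Ttheta Pphi hF]]] := IH (fun z Fz => sub z (or_intror Fz)).
  have [[theta' phi'] [/= Ttheta' Pphi'] psiE] := sub psi (or_introl erefl).
  have [theta2 T2 T2E] := dirT _ _ Ttheta Ttheta'.
  have [phi2 P2 P2E] := dirP _ _ Pphi Pphi'.
  exists theta2, phi2; split=> // v; have [m [x [y [t ->]]]] := etaV v.
  move=> /chiE[/T2E[m1 m2] /P2E[x1 x2] /P2E[y1 y2] cyt mxt] psi' [->|].
    by rewrite -psiE; apply/chiE.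
  by apply: hF; apply/chiE.
have [m [x [y [t vE]]]] := etaV v; exists m, x, y, t.
have h theta phi : Theta theta -> Phi phi -> [/\ sat SC (copair m j) theta,
    sat SC (copair x j) phi, sat SC (copair y j) phi, star_mul c y t & star_mul m x t].
  by move=> Tt Pp; apply/chiE; rewrite -vE; apply: hv; exists (theta, phi).
by split=> [theta Tt|phi Pp|phi Pp||]; [have [] := h _ _ Tt P0|have [] := h _ _ T0 Pp|
  have [] := h _ _ T0 Pp|have [] := h _ _ T0 P0|have [] := h _ _ T0 P0].
Qed.

End Extension.
(** * Extreme amenability and ultrafilters *)

Lemma ultra_dichotomy {T : Type} (F : set_system T) : ProperFilter F ->
  (forall P, F P \/ F (~` P)) -> UltraFilter F.
Proof.
move=> PF FC; split=> // F' PF' FF'; apply/seteqP; split=> // A F'A.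
have [//|/FF' F'nA] := FC A.
by have [x []] := filter_ex (filterI F'A F'nA).
Qed.

Section TopologicalGroup.
Context {G : topologicalGroupType}.
Implicit Types (g h : G) (U V P Q : set G).

Lemma nbhs1_mul U : nbhs (1%g : G) U ->
  exists2 V, nbhs (1%g : G) V & forall a b, V a -> V b -> U (a * b)%g.
Proof.
move=> U1; have := @mulg_continuous G (1%g, 1%g) U.
rewrite /= mulg1 => /(_ U1) [[A B] /= [A1 B1] AB].
exists (A `&` B); first exact: filterI.
by move=> a b [Aa _] [_ Bb]; exact: (AB (a, b)).
Qed.

Lemma nbhs1_inv U : nbhs (1%g : G) U -> nbhs (1%g : G) [set g | U g^-1%g].
Proof. by move=> U1; have := @invg_continuous G 1%g U; rewrite invg1; apply. Qed.

Lemma mulgl_continuous g : continuous (fun x : G => (g * x)%g).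
Proof.
move=> x A /(@mulg_continuous G (g, x) A) [[B D] /= [Bg Dx] BD].
by apply: filterS Dx => y Dy; apply: (BD (g, y)); split => //; exact: nbhs_singleton.
Qed.

Lemma mulgr_continuous g : continuous (fun x : G => (x * g)%g).
Proof.
move=> x A /(@mulg_continuous G (x, g) A) [[B D] /= [Bx Dg] BD].
by apply: filterS Bx => y By; apply: (BD (y, g)); split => //; exact: nbhs_singleton.
Qed.

Lemma nbhs1_conj g U : nbhs (1%g : G) U -> nbhs (1%g : G) [set x | U (g * x * g^-1)%g].
Proof.
move=> U1; have := @mulgl_continuous g 1%g [set x | U (x * g^-1)%g]; apply.
by rewrite mulg1; apply: (@mulgr_continuous g^-1%g g U); rewrite mulgV.
Qed.

Lemma nbhs_translate g U : nbhs (1%g : G) U -> nbhs g [set x | U (g^-1 * x)%g].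
Proof. by move=> U1; apply: (@mulgl_continuous g^-1%g g U); rewrite mulVg. Qed.

Definition thicken U P : set G := [set (u * p)%g | u in U & p in P].

Definition envelope (F : set_system G) : set_system G :=
  [set Q | exists U P, [/\ nbhs (1%g : G) U, F P & thicken U P `<=` Q]].

Lemma envelope_filter (F : set_system G) : ProperFilter F -> ProperFilter (envelope F).
Proof.
move=> PF; split.
  move=> [U [P [U1 FP UP0]]]; have [p Pp] := filter_ex FP.
  apply: (UP0 (1 * p)%g); exists 1%g; first exact: nbhs_singleton.
  by exists p.
split.
- by exists setT, setT; split=> //; exact: filterT.
- move=> Q Q' [U [P [U1 FP UPQ]]] [U' [P' [U1' FP' UPQ']]].
  exists (U `&` U'), (P `&` P'); split; [exact: filterI|exact: filterI|].
  move=> _ [u [Uu U'u] [p [Pp P'p] <-]]; split; [apply: UPQ|apply: UPQ'];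
    by exists u => //; exists p.
- move=> Q Q' QQ' [U [P [U1 FP UPQ]]]; exists U, P; split=> //.
  exact: subset_trans QQ'.
Qed.

Lemma envelope_thicken (F : set_system G) U P :
  nbhs (1%g : G) U -> F P -> envelope F (thicken U P).
Proof. by move=> U1 FP; exists U, P; split. Qed.

(** Given U P, let P' be the set of points u^-1 v p with u, v in a small
    neighborhood W' and p in P. It belongs to F': otherwise its complement does,
    and W' P, W' (~` P') are disjoint members of the two envelopes. As W' P' is
    contained in U P, the latter is in the envelope of F'. *)
Lemma envelope_sub (F F' : set_system G) : UltraFilter F' ->
  (forall Q Q', envelope F Q -> envelope F' Q' -> Q `&` Q' !=set0) ->
  envelope F `<=` envelope F'.
Proof.
move=> ultraF' meet Q [U [P [U1 FP UPQ]]].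
have [V V1 VU] := nbhs1_mul U1; have [W W1 WV] := nbhs1_mul V1.
pose W' := W `&` [set g | W g^-1%g].
have W'1 : nbhs (1%g : G) W' by apply: filterI => //; exact: nbhs1_inv.
have WVsub : forall x, W' x -> V x.
  move=> x [Wx _]; rewrite -[x]mulg1; apply: WV => //; exact: nbhs_singleton.
pose P' := [set x | exists u v p, [/\ W' u, W' v, P p & x = (u^-1 * v * p)%g]].
have F'P' : F' P'.
  have [//|F'nP'] := in_ultra_setVsetC P' ultraF'.
  have [_ [[v W'v [p Pp <-]] [u W'u [p' nP' e]]]] :=
    meet _ _ (envelope_thicken W'1 FP) (envelope_thicken W'1 F'nP').
  by case: nP'; exists u, v, p; rewrite -mulgA -e mulKg.
exists W', P'; split=> // _ [w W'w [_ [u [v [p [W'u W'v Pp ->]]]] <-]].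
apply: UPQ; exists (w * u^-1 * v)%g; last by exists p; rewrite // !mulgA.
by apply: VU; [apply: WV; [exact: W'w.1|exact: W'u.2]|exact: WVsub].
Qed.

End TopologicalGroup.

(** The greatest ambit of G (the Samuel compactification of its right
    uniformity): the quotient of the space of ultrafilters on G that identifies
    ultrafilters with the same envelope. The sets of envelopes containing a given
    Q form a base of its topology. *)
Definition samuel (G : topologicalGroupType) : Type :=
  {R : set_system G | exists2 F, UltraFilter F & R = envelope F}.

Section Samuel.
Context {G : topologicalGroupType}.
HB.instance Definition _ := gen_eqMixin (samuel G).
HB.instance Definition _ := gen_choiceMixin (samuel G).

Definition samuel_nbhs (r : samuel G) : set_system (samuel G) :=
  [set A | exists2 Q, sval r Q & [set s : samuel G | sval s Q] `<=` A].
HB.instance Definition _ := hasNbhs.Build (samuel G) samuel_nbhs.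

Lemma samuel_pfilter (r : samuel G) : ProperFilter (sval r).
Proof. by have [F Fultra ->] := svalP r; exact: envelope_filter. Qed.

Lemma samuel_nbhs_pfilter (r : samuel G) : ProperFilter (nbhs r).
Proof.
have rF := samuel_pfilter r; split.
  by move=> [Q rQ sub]; exact: sub rQ.
split.
- by exists setT => //; exact: filterT.
- move=> A B [Q rQ QA] [Q' rQ' QB]; exists (Q `&` Q'); first exact: filterI.
  by move=> s /= sQQ'; have sF := samuel_pfilter s; split; [apply: QA|apply: QB];
    apply: filterS sQQ' => x [].
- by move=> A B AB [Q rQ QA]; exists Q => //; exact: subset_trans AB.
Qed.

Lemma samuel_nbhs_singleton (r : samuel G) A : nbhs r A -> A r.
Proof. by move=> [Q rQ]; apply. Qed.

Lemma samuel_nbhs_nbhs (r : samuel G) A : nbhs r A -> nbhs r (nbhs^~ A).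
Proof. by move=> [Q rQ QA]; exists Q => // s sQ; exists Q. Qed.

HB.instance Definition _ := Nbhs_isNbhsTopological.Build (samuel G)
  samuel_nbhs_pfilter samuel_nbhs_singleton samuel_nbhs_nbhs.

Lemma samuel_hausdorff : hausdorff_space (samuel G).
Proof.
move=> r s clrs.
have meet Q Q' : sval r Q -> sval s Q' -> Q `&` Q' !=set0.
  move=> rQ sQ'.
  have [||t [/= tQ tQ']] := clrs [set t : samuel G | sval t Q] [set t : samuel G | sval t Q'] _ _.
  - by exists Q.
  - by exists Q'.
  by have tF := samuel_pfilter t; exact: filter_ex (filterI tQ tQ').
have [F Fultra rE] := svalP r; have [F' F'ultra sE] := svalP s.
apply: eq_sig_hprop => [R|]; first exact: Prop_irrelevance.
apply/seteqP; split; rewrite rE sE; apply: envelope_sub => Q Q'; rewrite -rE -sE.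
  exact: meet.
by rewrite setIC => ? ?; exact: meet.
Qed.

(** Choosing an ultrafilter in each class turns an ultrafilter W of classes into
    one on G, namely the W-limit of the chosen ones; its class is the limit
    of W. *)
Lemma samuel_compact : compact [set: samuel G].
Proof.
rewrite compact_ultra => W Wultra _.
have /choice[ult ultP] (r : samuel G) : exists F, UltraFilter F /\ sval r = envelope F.
  by have [F Fultra rE] := svalP r; exists F.
pose F : set_system G := [set P | W [set r | ult r P]].
have FE P : F P = W [set r | ult r P] by [].
have Fproper : ProperFilter F.
  split.
    rewrite FE => WF; have [r] := filter_ex WF.
    by have [ru _] := ultP r; exact: filter_not_empty.
  split.
  - by rewrite FE; apply: filterS filterT => r _; have [ru _] := ultP r; exact: filterT.
  - move=> P Q; rewrite !FE => WP WQ; apply: filterS (filterI WP WQ) => r [rP rQ].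
    by have [ru _] := ultP r; exact: filterI.
  - move=> P Q PQ; rewrite !FE; apply: filterS => r.
    by have [ru _] := ultP r; exact: filterS.
have Fultra : UltraFilter F.
  apply: ultra_dichotomy => P; rewrite !FE.
  have [WP|WnP] := in_ultra_setVsetC [set r | ult r P] Wultra; [by left|right].
  apply: filterS WnP => r /= nrP; have [ru _] := ultP r.
  by have [/nrP|] := in_ultra_setVsetC P ru.
exists (exist _ (envelope F) (ex_intro2 _ _ F Fultra erefl)); split => // A.
move=> [Q [U [P [U1 FP UPQ]]] QA].
rewrite FE in FP; apply: filterS FP => r rP; apply: QA; have [ru rE] := ultP r.
by rewrite /= rE; exists U, P.
Qed.

Lemma samuel_act_subproof g (r : samuel G) : exists2 F, UltraFilter F &
  [set Q | sval r [set x | Q (g * x)%g]] = envelope F.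
Proof.
have [F Fultra rE] := svalP r; exists [set P | F [set x | P (g * x)%g]].
  by apply: ultra_dichotomy => P; exact: (in_ultra_setVsetC [set x | P (g * x)%g]).
rewrite rE; apply/seteqP; split=> Q [U [P [U1 FP UPQ]]].
  exists [set u | U (g^-1 * u * g^-1^-1)%g], [set x | P (g^-1 * x)%g]; split.
  - exact: nbhs1_conj.
  - change (F [set x | P (g^-1 * (g * x))%g]).
    by apply: filterS FP => x Px /=; rewrite mulKg.
  - move=> _ [u Uu [p Pp <-]].
    have : thicken U P (g^-1 * (u * p))%g.
      by exists (g^-1 * u * g^-1^-1)%g => //; exists (g^-1 * p)%g => //; rewrite invgK !mulgA mulgK.
    by move=> /UPQ /=; rewrite mulVKg.
exists [set u | U (g * u * g^-1)%g], [set x | P (g * x)%g]; split => //.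
- exact: nbhs1_conj.
- move=> _ [u Uu [p Pp <-]] /=; apply: UPQ.
  by exists (g * u * g^-1)%g => //; exists (g * p)%g => //; rewrite !mulgA mulgVK.
Qed.

Definition samuel_act g (r : samuel G) : samuel G :=
  exist _ _ (samuel_act_subproof g r).


Lemma samuel_act_sval g (r : samuel G) Q :
  sval (samuel_act g r) Q = sval r [set x | Q (g * x)%g].
Proof. by []. Qed.

Lemma samuel_eq (r s : samuel G) : sval r = sval s -> r = s.
Proof. by move=> e; apply: eq_sig_hprop e => R; exact: Prop_irrelevance. Qed.

Lemma samuel_act1 r : samuel_act 1%g r = r.
Proof.
apply: samuel_eq; apply/funext => Q; rewrite samuel_act_sval.
by congr (sval r _); apply/funext => x /=; rewrite mul1g.
Qed.

Lemma samuel_actM g h r : samuel_act (g * h)%g r = samuel_act g (samuel_act h r).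
Proof.
apply: samuel_eq; apply/funext => Q; rewrite !samuel_act_sval.
by congr (sval r _); apply/funext => x /=; rewrite mulgA.
Qed.

(** If g^-1 Q contains U P and V V is inside U, then h^-1 Q contains V P for
    every h in g V. *)
Lemma samuel_act_continuous :
  continuous (fun gr : G * samuel G => samuel_act gr.1 gr.2).
Proof.
move=> [g r] A [Q]; rewrite samuel_act_sval => rQ QA.
have [F Fultra rE] := svalP r.
have [U [P [U1 FP UPQ]]] : envelope F [set x | Q (g * x)%g] by rewrite -rE.
have [V V1 VU] := nbhs1_mul U1.
exists ([set h | V (g^-1 * h)%g], [set s | sval s (thicken V P)]) => /=.
  split; first exact: nbhs_translate.
  by exists (thicken V P) => //; rewrite rE; exact: envelope_thicken.
move=> [h s] [/= Vh sVP]; apply: QA.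
change (sval s [set x | Q (h * x)%g]).
have sF := samuel_pfilter s; apply: filterS sVP => _ [v Vv [p Pp <-]] /=.
have : thicken U P (g^-1 * h * v * p)%g.
  by exists (g^-1 * h * v)%g; [exact: VU|exists p].
by move=> /UPQ /=; rewrite !mulgA mulgV mul1g.
Qed.

(** If the class of F is a fixed point, W P and W g P both belong to its envelope,
    so they meet: w x = w' g y, that is, g y = (w'^-1 w) x. *)
Lemma extremely_amenable_ultrafilter : extremely_amenable G ->
  exists2 F : set_system G, UltraFilter F & forall g P U, F P -> nbhs (1%g : G) U ->
    exists x y u, [/\ P x, P y, U u & (g * y)%g = (u * x)%g].
Proof.
move=> amen.
have [||||||r fix_r] := amen (samuel G : topologicalType) samuel_act.
- pose F : set_system G := principal_filter 1%g.
  have Fultra : UltraFilter F := principal_filter_ultra _.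
  by exists (exist _ (envelope F) (ex_intro2 _ _ F Fultra erefl)).
- exact: samuel_compact.
- exact: samuel_hausdorff.
- exact: samuel_act1.
- exact: samuel_actM.
- exact: samuel_act_continuous.
have [F Fultra rE] := svalP r; exists F => // g P U FP U1.
have [V V1 VU] := nbhs1_mul U1.
pose W := V `&` [set x | V x^-1%g].
have W1 : nbhs (1%g : G) W by apply: filterI => //; exact: nbhs1_inv.
have rWP : sval r (thicken W P) by rewrite rE; exact: envelope_thicken.
have rWgP : sval r (thicken W [set (g * y)%g | y in P]).
  rewrite -(fix_r g) samuel_act_sval rE.
  exists [set u | W (g * u * g^-1)%g], P; split=> //; first exact: nbhs1_conj.
  move=> _ [u Wu [p Pp <-]] /=; exists (g * u * g^-1)%g => //.
  by exists (g * p)%g; [exists p|rewrite !mulgA mulgVK].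
have rF := samuel_pfilter r.
have [_ [[w Ww [x Px <-]] [w' Ww' [_ [y Py <-]] e]]] := filter_ex (filterI rWP rWgP).
exists x, y, (w'^-1 * w)%g; split=> //; first by apply: VU; [exact: Ww'.2|exact: Ww.1].
by rewrite -mulgA -e mulKg.
Qed.

End Samuel.
(** * The components *)

Section Components.
Context {L E : language} {M C K : Type}.
Context (SM : structure (lang_sum L E) M) (SC : structure (lang_sum L E) C).
Context (j : M -> C) (n : nat) (G : topologicalGroupType) (iota : G -> 'I_n -> M).
Context (K_limit : strong_limit K).
Context (C_monster : monster K (reduct SM) (reduct SC) j).
Context (C_monster' : monster K SM SC j).
Context (M_inhabited : inhabited M).
Context (K_large : @small K _ [set: formula (lang_sum L E) (nat + M)]).
Context (iota_inj : injective iota).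
Context (delta : formula L ('I_n + M)) (gamma : formula L ('I_n + 'I_n + 'I_n + M)).
Context (deltaM : solset (reduct SM) id delta = range iota).
Context (gammaM : solset (reduct SM) id gamma = mul_graph iota).

Local Notation Gs := (Gstar SM SC j iota).
Local Notation op := (smul SM SC j iota).
Local Notation e := (embG j iota 1%g).
Local Notation subgp := (subgroup SM SC j iota).
Local Notation bounded := (bounded_index SM SC j K iota).
Local Notation stmul := (star_mul SM SC j iota).

Lemma solset_lift V A (c : A -> M) (phi : formula L (V + A)) D :
  solset (reduct SM) c phi = D -> solset SM c (lift_formula (E := E) phi) = D.
Proof. by move=> <-; apply/funext => v; rewrite /solset /mkset sat_lift. Qed.

Lemma star_reduct (V : finType) (phi : formula L (V + M)) D :
  solset (reduct SM) id phi = D -> star SM SC j D = solset (reduct SC) j phi.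
Proof.
move=> /solset_lift phiD; rewrite (star_solset C_monster' phiD).
by apply/funext => v; rewrite /solset /mkset sat_lift.
Qed.

Let deltaM' := solset_lift deltaM.
Let gammaM' := solset_lift gammaM.
Let grp : group_on Gs op e := Gstar_group C_monster' iota_inj deltaM' gammaM'.
Let opP := star_mulP C_monster' iota_inj deltaM' gammaM'.

Lemma embG_in_Gstar g : Gs (embG j iota g).
Proof. exact: (Gstar_embG C_monster' deltaM' g). Qed.

Lemma small_model : @small K _ (range j).
Proof.
apply: small_image; apply: le_small K_large; apply: card_le_injP.
exists (fun m => Eq (@Var (lang_sum L E) (nat + M) (inr m)) (@Var _ _ (inr m))) => //.
by move=> m m' _ _ [].
Qed.

Lemma automorphism_reduct sigma :
  automorphism SC sigma -> automorphism (reduct SC) sigma.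
Proof.
by case=> bij fun_sigma rel_sigma; split=> // f ts;
  [exact: (fun_sigma (inl f))|exact: (rel_sigma (inl f))].
Qed.

Lemma invariant_reduct (H : set ('I_n -> C)) : Defs.invariant j (reduct SC) H -> Defs.invariant j SC H.
Proof. by move=> inv sigma /automorphism_reduct; exact: inv. Qed.

Lemma Gstar_delta a : Gs a <-> sat (reduct SC) (copair a j) delta.
Proof. by rewrite /Gstar (star_reduct deltaM). Qed.

Lemma smul_gamma a b c : Gs a -> Gs b -> c = op a b <->
  sat (reduct SC) (copair (copair (copair a b) c) j) gamma.
Proof. by move=> Ga Gb; rewrite opP // /star_mul (star_reduct gammaM). Qed.

Lemma Gstar_delta' a : Gs a <-> sat SC (copair a j) (lift_formula (E := E) delta).
Proof. by rewrite Gstar_delta sat_lift. Qed.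

Lemma smul_gamma' a b c : Gs a -> Gs b -> c = op a b <->
  sat SC (copair (copair (copair a b) c) j) (lift_formula (E := E) gamma).
Proof. by move=> Ga Gb; rewrite smul_gamma // sat_lift. Qed.

Lemma invariant_left_coset H : subgp H -> bounded H -> Defs.invariant j SC H ->
  forall x y, Gs x -> same_type SC j x y -> same_left_coset op H x y.
Proof.
move=> subH bH iH x y.
exact: (same_type_same_coset K_limit C_monster' small_model grp
  Gstar_delta' smul_gamma' subH bH iH).
Qed.

Lemma bounded_of_types H : subgp H ->
  (forall x y, Gs x -> Gs y -> same_type SC j x y -> same_left_coset op H x y) ->
  bounded H.
Proof. by move=> subH; exact: (types_bound_index K_limit M_inhabited K_large grp subH). Qed.

Lemma Gstar_subgroup : subgp Gs.
Proof. exact: group_on_subgroup grp. Qed.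

Lemma Gstar_bounded : bounded Gs.
Proof.
apply: bounded_of_types Gstar_subgroup _ => x y Gx Gy _.
have [x' Gx' [xx' _]] := group_onV grp Gx; exists (op x' y).
  exact: group_onM grp _ _ Gx' Gy.
by rewrite (group_onA grp) // xx' (group_on1l grp).
Qed.

Lemma bigcap_subgroup (P : set (set ('I_n -> C))) :
  P !=set0 -> (forall H, P H -> subgp H) -> subgp (\bigcap_(H in P) H).
Proof.
move=> [H0 PH0] subP; split.
- by move=> a /(_ _ PH0); case: (subP _ PH0) => HG _ _ _; exact: HG.
- by move=> H /subP[].
- by move=> a b Ia Ib H PH; case: (subP _ PH) => _ _ HM _; apply: HM; [exact: Ia|exact: Ib].
- move=> a Ia; case: (subP _ PH0) => HG _ _ HV; have [b Hb ab] := HV _ (Ia _ PH0).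
  have Ga := HG _ (Ia _ PH0); have Gb := HG _ Hb.
  exists b => // H PH; case: (subP _ PH) => HG' _ _ HV'.
  have [b' Hb' ab'] := HV' _ (Ia _ PH); suff -> : b = b' by [].
  have Gb' := HG' _ Hb'; have ba := group_on_rinv_linv grp Ga Gb ab.
  rewrite -(group_on1r grp Gb) -ab' (group_onA grp) // ba.
  by rewrite (group_on1l grp).
Qed.

(** Each H of the family contains x^-1 y whenever x and y have the same type, hence
    so does the intersection. *)
Lemma bigcap_bounded (P : set (set ('I_n -> C))) : P !=set0 ->
  (forall H, P H -> [/\ subgp H, bounded H & Defs.invariant j SC H]) ->
  bounded (\bigcap_(H in P) H).
Proof.
move=> P0 PP; apply: bounded_of_types.
  by apply: bigcap_subgroup => // H /PP[].
move=> x y Gx Gy xy; have [x' Gx' [xx' x'x]] := group_onV grp Gx.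
exists (op x' y); last by rewrite (group_onA grp) // xx' (group_on1l grp).
move=> H PH; have [subH bH iH] := PP _ PH.
have [h Hh ->] := invariant_left_coset subH bH iH Gx xy.
have Gh : Gs h by case: subH => HG _ _ _; exact: HG.
by rewrite (group_onA grp) // x'x (group_on1l grp).
Qed.

Lemma Gstar_invariant : Defs.invariant j SC Gs.
Proof. by move=> sigma autS fixM a; exact: star_invariant. Qed.

Lemma type_definable_invariant (H : set ('I_n -> C)) : type_definable SC j H -> Defs.invariant j (reduct SC) H.
Proof.
move=> [Sigma ->] sigma autS fixM a Ia phi Sphi.
have fixj : sigma \o j = j by apply/funext.
by have /(automorphism_sat _ _ autS) := Ia phi Sphi; rewrite copair_comp fixj.
Qed.

Lemma open_intersection_invariant H :
  open_intersection SM SC j iota H -> Defs.invariant j SC H.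
Proof.
move=> [F _ ->] sigma autS fixM a Ia U FU; apply: star_invariant => //; exact: Ia.
Qed.

(** An open U with 1 in U* contains 1, by elementarity, so U* contains mu. *)
Lemma mu_sub_open_intersection H : subgp H ->
  open_intersection SM SC j iota H -> mu SM SC j iota `<=` H.
Proof.
case=> _ + _ _ [F Fopen HE]; rewrite HE => He m mum U FU; apply: mum; split.
  exact: Fopen.
have [phi phiU sphi] := He _ FU.
have : solset SM id phi (iota 1%g).
  by apply/(sat_elementary C_monster'); rewrite copair_comp.
by rewrite phiU => -[u Uu /iota_inj <-].
Qed.

Lemma G000_M_spec : [/\ subgp (G000_M SM SC j K iota), bounded (G000_M SM SC j K iota)
  & Defs.invariant j (reduct SC) (G000_M SM SC j K iota)].
Proof.
pose P := [set H | [/\ subgp H, bounded H & Defs.invariant j (reduct SC) H]].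
have P0 : P !=set0.
  exists Gs; split; [exact: Gstar_subgroup|exact: Gstar_bounded|].
  apply: type_definable_invariant; exists [set delta].
  by rewrite bigcap_set1 -(star_reduct deltaM).
have PI : P (\bigcap_(H in P) H).
  split; first by apply: bigcap_subgroup => // H [].
    by apply: bigcap_bounded => // H [? ? /invariant_reduct].
  by move=> sigma autS fixM a Ia H PH; have [_ _ iH] := PH; apply: iH => //; exact: Ia.
by rewrite /G000_M -/P (smallest_of_bigcap PI).
Qed.

Lemma G00_M_spec : [/\ subgp (G00_M SM SC j K iota), bounded (G00_M SM SC j K iota)
  & Defs.invariant j (reduct SC) (G00_M SM SC j K iota)].
Proof.
pose P := [set H | [/\ subgp H, bounded H & type_definable SC j H]].
have P0 : P !=set0.
  exists Gs; split; [exact: Gstar_subgroup|exact: Gstar_bounded|exists [set delta]].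
  by rewrite bigcap_set1 -(star_reduct deltaM).
have PI : P (\bigcap_(H in P) H).
  split; first by apply: bigcap_subgroup => // H [].
    by apply: bigcap_bounded => // H [? ? /type_definable_invariant/invariant_reduct].
  exists [set phi | exists Sigma,
    P (\bigcap_(phi in Sigma) solset (reduct SC) j phi) /\ Sigma phi].
  apply/seteqP; split=> a Ia.
    by move=> phi [Sigma [PS Sphi]]; exact: Ia PS _ Sphi.
  move=> H PH; have [_ _ [Sigma HE]] := PH; rewrite HE => phi Sphi.
  by apply: Ia; exists Sigma; rewrite -HE.
rewrite /G00_M -/P (smallest_of_bigcap PI); have [? ? /type_definable_invariant ?] := PI.
by [].
Qed.

Lemma G00_top_spec : [/\ subgp (G00_top SM SC j K iota),
  bounded (G00_top SM SC j K iota), Defs.invariant j SC (G00_top SM SC j K iota)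
  & mu SM SC j iota `<=` G00_top SM SC j K iota].
Proof.
pose P := [set H | [/\ subgp H, bounded H & open_intersection SM SC j iota H]].
have P0 : P !=set0.
  exists Gs; split; [exact: Gstar_subgroup|exact: Gstar_bounded|exists [set setT]].
    by move=> _ ->; exact: openT.
  by rewrite bigcap_set1.
have PI : P (\bigcap_(H in P) H).
  split; first by apply: bigcap_subgroup => // H [].
    by apply: bigcap_bounded => // H [? ? /open_intersection_invariant].
  exists [set U | exists F, [/\ F `<=` open,
    P (\bigcap_(U in F) star SM SC j (iota @` U)) & F U]].
    by move=> U [F [Fopen _ FU]]; exact: Fopen.
  apply/seteqP; split=> a Ia.
    by move=> U [F [_ PF FU]]; exact: Ia PF _ FU.
  move=> H PH; have [_ _ [F Fopen HE]] := PH; rewrite HE => U FU.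
  by apply: Ia; exists F; rewrite -HE.
rewrite /G00_top -/P (smallest_of_bigcap PI); have [sI bI oI] := PI.
by split=> //; [exact: open_intersection_invariant|exact: mu_sub_open_intersection].
Qed.

Lemma mu_sub_Gstar : mu SM SC j iota `<=` Gs.
Proof. by move=> m; apply; split=> //; exact: openT. Qed.

Lemma G000_top_spec : [/\ subgp (G000_top SM SC j K iota),
  bounded (G000_top SM SC j K iota), Defs.invariant j SC (G000_top SM SC j K iota)
  & mu SM SC j iota `<=` G000_top SM SC j K iota].
Proof.
pose P := [set H | [/\ subgp H, normal_in_Gstar SM SC j iota H, bounded H,
                       Defs.invariant j SC H & mu SM SC j iota `<=` H]].
have P0 : P !=set0.
  exists Gs; split; [exact: Gstar_subgroup| |exact: Gstar_bounded|
    exact: Gstar_invariant|exact: mu_sub_Gstar].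
  move=> a Ga; have [a' Ga' [aa' a'a]] := group_onV grp Ga.
  have GM := group_onM grp.
  apply/seteqP; split=> _ [h Gh <-].
    exists (op (op a h) a'); first exact: (GM _ _ (GM _ _ Ga Gh) Ga').
    by rewrite -(group_onA grp) ?a'a ?(group_on1r grp) //; exact: GM.
  exists (op a' (op h a)); first exact: (GM _ _ Ga' (GM _ _ Gh Ga)).
  by rewrite (group_onA grp) ?aa' ?(group_on1l grp) //; exact: GM.
have PI : P (\bigcap_(H in P) H).
  have subI : subgp (\bigcap_(H in P) H) by apply: bigcap_subgroup => // H [].
  have GI : \bigcap_(H in P) H `<=` Gs by case: subI.
  split=> //.
  - move=> a Ga; have [a' Ga' [aa' a'a]] := group_onV grp Ga.
    have GM := group_onM grp.
    apply/seteqP; split=> _ [h Ih <-]; have Gh := GI _ Ih.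
      exists (op (op a h) a').
        move=> H PH; have [[HG _ _ _] nH _ _ _] := PH.
        have : (op a @` H) (op a h) by exists h => //; exact: Ih.
        rewrite nH // => -[k Hk <-].
        by rewrite -(group_onA grp) ?aa' ?(group_on1r grp) //; exact: HG.
      by rewrite -(group_onA grp) ?a'a ?(group_on1r grp) //; exact: GM.
    exists (op a' (op h a)).
      move=> H PH; have [[HG _ _ _] nH _ _ _] := PH.
      have : ((op ^~ a) @` H) (op h a) by exists h => //; exact: Ih.
      rewrite -nH // => -[k Hk <-].
      by rewrite (group_onA grp) ?a'a ?(group_on1l grp) //; exact: HG.
    by rewrite (group_onA grp) ?aa' ?(group_on1l grp) //; exact: GM.
  - by apply: bigcap_bounded => // H [].
  - by move=> sigma autS fixM a Ia H PH; have [_ _ _ iH _] := PH; apply: iH => //; exact: Ia.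
  - by move=> m mum H [_ _ _ _]; apply.
by rewrite /G000_top -/P (smallest_of_bigcap PI); have [] := PI.
Qed.


Lemma invariant_right_coset H : subgp H -> bounded H -> Defs.invariant j SC H ->
  forall x y, Gs x -> same_type SC j x y -> exists2 h, H h & x = op h y.
Proof.
move=> subH bH iH x y Gx xy.
apply: (same_type_same_right_coset K_limit C_monster' small_model grp
  Gstar_delta' smul_gamma' subH bH iH _ Gx xy).
by move=> sigma autS fixM; apply/funext => i; exact: fixM.
Qed.

Lemma reduct_invariant_right_coset H :
  subgp H -> bounded H -> Defs.invariant j (reduct SC) H ->
  forall x y, Gs x -> same_type (reduct SC) j x y -> exists2 h, H h & x = op h y.
Proof.
move=> subH bH iH x y Gx xy.
apply: (same_type_same_right_coset K_limit C_monster small_model grp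
  Gstar_delta smul_gamma subH bH iH _ Gx xy).
by move=> sigma autS fixM; apply/funext => i; exact: fixM.
Qed.

(** * Fixed types and the conclusion *)

(** From c y = m x and x = h y one gets c = m h by cancelling y. *)
Lemma Gstar_factor_coset Theta Phi H :
  directed SC j Theta -> directed SC j Phi ->
  (forall g theta phi, Theta theta -> Phi phi -> exists m x y t,
    [/\ sat SC (copair m j) theta, sat SC (copair x j) phi, sat SC (copair y j) phi,
        stmul (embG j iota g) y t & stmul m x t]) ->
  H `<=` Gs ->
  (forall x y, Gs x -> realizes SC j Phi x -> realizes SC j Phi y ->
    exists2 h, H h & x = op h y) ->
  forall c, Gs c -> exists m h, [/\ realizes SC j Theta m, H h & c = op m h].
Proof.
move=> dirT dirP dense HG Phi_coset c Gc.
have [m [x [y [t [Tm Px Py cyt mxt]]]]] := Gstar_factor C_monster'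
  deltaM' gammaM' K_limit small_model dirT dirP dense Gc.
have dom := star_mul_domain C_monster' deltaM' gammaM'.
have [_ Gy _] := dom _ _ _ cyt; have [Gm Gx _] := dom _ _ _ mxt.
have [h Hh xE] := Phi_coset _ _ Gx Px Py; exists m, h; split=> //.
have Gh := HG _ Hh; have [y' Gy' [yy' _]] := group_onV grp Gy.
have GM := group_onM grp.
have : op c y = op (op m h) y.
  rewrite -(group_onA grp) // -xE.
  by move/opP: cyt => <- //; move/opP: mxt => <-.
move=> /(congr1 (fun z => op z y')).
have Gmh := GM _ _ Gm Gh.
rewrite -(group_onA grp Gc Gy Gy') -(group_onA grp Gmh Gy Gy') yy'.
by rewrite (group_on1r grp Gc) (group_on1r grp Gmh).
Qed.

Definition nbhs1_formulas : set (formula (lang_sum L E) ('I_n + M)) :=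
  [set theta | exists U : set G, [/\ open U, U 1%g & solset SM id theta = iota @` U]].

Lemma nbhs1_formulas_directed : directed SC j nbhs1_formulas.
Proof.
split; first by exists (lift_formula delta), setT; split=> //; exact: openT.
move=> theta theta' [U [Uo U1 UE]] [U' [Uo' U1' UE']]; exists (fand theta theta').
  exists (U `&` U'); split=> //; first exact: openI.
  apply/seteqP; split=> a.
    rewrite /solset /mkset sat_fand => -[].
    rewrite -[sat _ _ theta]/(solset SM id theta a) -[sat _ _ theta']/(solset SM id theta' a).
    by rewrite UE UE' => -[u Uu <-] [u' Uu' /iota_inj uu']; exists u => //; split => //; rewrite -uu'.
  move=> [u [Uu U'u] <-]; rewrite /solset /mkset sat_fand.
  rewrite -[sat _ _ theta]/(solset SM id theta _) -[sat _ _ theta']/(solset SM id theta' _).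
  by rewrite UE UE'; split; exists u.
by move=> a; rewrite sat_fand.
Qed.

Lemma open_definable (U : set G) : names_opens SM iota -> open U ->
  exists theta : formula (lang_sum L E) ('I_n + M), solset SM id theta = iota @` U.
Proof.
move=> names Uo; have [r [er rE]] := names U Uo.
exists (@Rel (lang_sum L E) _ r
  (fun i => @Var (lang_sum L E) ('I_n + M) (inl (cast_ord er i)))).
by apply/funext => a; apply/propext; exact: rE.
Qed.

Lemma mu_realizes m : mu SM SC j iota m -> realizes SC j nbhs1_formulas m.
Proof.
move=> mum theta [U [Uo U1 UE]]; have := mum U (conj Uo U1).
by rewrite (star_solset C_monster' UE).
Qed.

Lemma realizes_mu m : names_opens SM iota ->
  realizes SC j nbhs1_formulas m -> mu SM SC j iota m.
Proof.
move=> names rm U [Uo U1]; have [theta thetaE] := open_definable names Uo.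
by rewrite (star_solset C_monster' thetaE); apply: rm; exists U.
Qed.

Lemma mu_identity : names_opens SM iota -> mu SM SC j iota e.
Proof.
move=> names U [Uo U1]; have [theta thetaE] := open_definable names Uo.
by apply: (star_emb C_monster' thetaE); exists 1%g.
Qed.

(** The type of a over M in the small language, viewed in the large one, where it
    can be combined with names for open sets. *)
Definition type_formulas (a : 'I_n -> C) : set (formula (lang_sum L E) ('I_n + M)) :=
  [set phi | exists2 psi, sat (reduct SC) (copair a j) psi & phi = lift_formula psi].

Lemma type_formulas_directed a : directed SC j (type_formulas a).
Proof.
split; first by exists ftrue, ftrue.
move=> _ _ [psi apsi ->] [psi' apsi' ->]; exists (lift_formula (fand psi psi')).
  by exists (fand psi psi') => //; rewrite sat_fand.
by move=> x; rewrite !sat_lift sat_fand.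
Qed.

Lemma realizes_type_formulas a x :
  realizes SC j (type_formulas a) x <-> same_type (reduct SC) j a x.
Proof.
split=> [h phi|ax _ [psi apsi ->]]; last by rewrite sat_lift; apply/ax.
have sub psi : sat (reduct SC) (copair a j) psi -> sat (reduct SC) (copair x j) psi.
  by move=> apsi; rewrite -sat_lift; apply: h; exists psi.
split; first exact: sub.
by move=> xphi; apply: contrapT => /(sub (fnot phi)) /(_ xphi).
Qed.

Lemma group_type_realized p : group_types SM iota p ->
  exists2 a, realizations SC j p a & Gs a /\
    forall x, realizations SC j p x <-> same_type (reduct SC) j a x.
Proof.
move=> [[pfs pcomp] [dp pdp dpE]].
have [||a ha] := @saturated_fin _ _ _ K (reduct SM) (reduct SC) j K_limit C_monster
    'I_n _ j p.
- exact: small_model.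
- move=> F Ffin Fp; have [a ha] := pfs F Ffin Fp; exists (j \o a) => phi Fphi.
  have /(sat_elementary C_monster) := ha phi Fphi.
  by rewrite copair_comp.
exists a => //; split.
  by rewrite /Gstar (star_reduct dpE); exact: ha.
move=> x; split=> [px phi|ax phi pphi]; last by apply/ax; exact: ha.
have [pphi|pnphi] := pcomp phi.
  by split=> _; [exact: px|exact: ha].
by split=> h; [case: (ha _ pnphi h)|case: (px _ pnphi h)].
Qed.

(** [translate g p] is the type of g a over M for one realization a of p only if
    it does not depend on a: any two realizations are conjugate over M. *)
Lemma smul_embG_translate g p a : group_types SM iota p -> realizations SC j p a ->
  realizations SC j (translate SM SC j iota g p) (op (embG j iota g) a).
Proof.
move=> Gp pa phi [a' pa' phia']; have [b pb [Gb bE]] := group_type_realized Gp.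
have ba := (bE _).1 pa; have ba' := (bE _).1 pa'.
have Ga' := same_type_Gs Gstar_delta ba' Gb.
have [||sigma autS sE] := @homogeneous_tuple _ _ _ _ _ _ _ C_monster _
    (copair a' j) (copair a j).
- exact: small_range_copair small_model.
- by move=> psi; split=> [/ba'/ba|/ba/ba'].
have fixM m : sigma (j m) = j m := sE (inr m).
have fixj : sigma \o j = j by apply/funext.
have <- : sigma \o op (embG j iota g) a' = op (embG j iota g) a.
  rewrite (automorphism_op Gstar_delta smul_gamma autS fixM (embG_in_Gstar g) Ga').
  by congr op; apply/funext => i; [exact: fixM|exact: sE (inl i)].
by rewrite /solset /mkset -[in X in copair _ X]fixj -copair_comp; apply/automorphism_sat.
Qed.

(** If a realizes the type p whose mu-class is fixed, then g a = 1 (g a) is in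
    mu (g p) = mu p, which provides g a = m x with x realizing p. *)
Lemma def_top_factor H : names_opens SM iota ->
  def_top_extremely_amenable SM SC j iota ->
  subgp H -> bounded H -> Defs.invariant j (reduct SC) H ->
  forall c, Gs c -> exists m h, [/\ mu SM SC j iota m, H h & c = op m h].
Proof.
move=> names [p Gp fixp] subH bH iH.
have [a pa [Ga aE]] := group_type_realized Gp.
have HG : H `<=` Gs by case: subH.
suff dense : forall g theta phi, nbhs1_formulas theta -> type_formulas a phi ->
    exists m x y t, [/\ sat SC (copair m j) theta, sat SC (copair x j) phi,
      sat SC (copair y j) phi, stmul (embG j iota g) y t & stmul m x t].
  move=> c Gc; have [x y Gx|m [h [mT Hh cE]]] := Gstar_factor_coset nbhs1_formulas_directed
    (type_formulas_directed a) dense HG _ Gc.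
    move=> /realizes_type_formulas ax /realizes_type_formulas ay.
    by apply: (reduct_invariant_right_coset subH bH iH Gx) => phi; split=> [/ax/ay|/ay/ax].
  by exists m, h; split=> //; exact: realizes_mu.
move=> g theta phi [U [Uo U1 UE]] aphi.
have : mu_class SM SC j iota (translate SM SC j iota g p) p.
  by rewrite fixp; split.
move=> [_ mueq].
have Gg := embG_in_Gstar g.
have Gga := group_onM grp Gg Ga.
have [m mum [x px mxE]] : setmul SM SC j iota (mu SM SC j iota) (realizations SC j p)
    (op (embG j iota g) a).
  rewrite -mueq; exists e; first exact: mu_identity.
  exists (op (embG j iota g) a); first exact: smul_embG_translate.
  by rewrite (group_on1l grp).
have Gm := mu_sub_Gstar mum.
have Gx := same_type_Gs Gstar_delta ((aE _).1 px) Ga.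
exists m, x, a, (op (embG j iota g) a); split.
- exact: (mu_realizes mum) (ex_intro _ U (And3 Uo U1 UE)).
- by apply: (realizes_type_formulas a x).2 aphi; apply/aE.
- by apply: (realizes_type_formulas a a).2 aphi; apply/aE.
- exact/opP.
- by apply/opP => //; rewrite mxE.
Qed.

(** Here g a itself realizes p, so the factor m can be required to have the type
    of 1 over M, and 1 is the only element with this type. *)
Lemma def_amenable_sub H : def_extremely_amenable SM SC j iota ->
  subgp H -> bounded H -> Defs.invariant j (reduct SC) H -> Gs `<=` H.
Proof.
move=> [p Gp fixp] subH bH iH c Gc.
have [a pa [Ga aE]] := group_type_realized Gp.
have HG : H `<=` Gs by case: subH.
suff dense : forall g theta phi, type_formulas e theta -> type_formulas a phi ->
    exists m x y t, [/\ sat SC (copair m j) theta, sat SC (copair x j) phi,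
      sat SC (copair y j) phi, stmul (embG j iota g) y t & stmul m x t].
  have [x y Gx|m [h [me Hh cE]]] := Gstar_factor_coset (type_formulas_directed e)
    (type_formulas_directed a) dense HG _ Gc.
    move=> /realizes_type_formulas ax /realizes_type_formulas ay.
    by apply: (reduct_invariant_right_coset subH bH iH Gx) => phi; split=> [/ax/ay|/ay/ax].
  have mE : m = e.
    apply/funext => i; symmetry.
    have := (realizes_type_formulas e m).1 me
      (Eq (@Var L _ (inl i)) (@Var L _ (inr (iota 1%g i)))).
    by case=> + _ => /(_ erefl) /= ->.
  by rewrite cE mE (group_on1l grp) //; exact: HG.
move=> g theta phi etheta aphi.
have Gg := embG_in_Gstar g.
have Gga := group_onM grp Gg Ga.
have pga : realizations SC j p (op (embG j iota g) a).
  by rewrite -(fixp g); exact: smul_embG_translate.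
exists e, (op (embG j iota g) a), a, (op (embG j iota g) a); split.
- by case: etheta => psi epsi ->; rewrite sat_lift.
- by apply: (realizes_type_formulas a _).2 aphi; apply/aE.
- by apply: (realizes_type_formulas a a).2 aphi; apply/aE.
- exact/opP.
- exact: (star_mul_id C_monster' deltaM' gammaM' Gga).1.
Qed.

Definition ultra_formulas (F : set_system G) :
    set (formula (lang_sum L E) ('I_n + M)) :=
  [set phi | F [set g | sat SM (copair (iota g) id) phi]].

Lemma amenable_factor H : names_opens SM iota -> extremely_amenable G ->
  subgp H -> bounded H -> Defs.invariant j SC H ->
  forall c, Gs c -> exists m h, [/\ mu SM SC j iota m, H h & c = op m h].
Proof.
move=> names /extremely_amenable_ultrafilter[F Fultra Fdense] subH bH iH c Gc.
have HG : H `<=` Gs by case: subH.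
have dirF : directed SC j (ultra_formulas F).
  split; first by exists ftrue; apply: filterS filterT => g _.
  move=> phi psi Fphi Fpsi; exists (fand phi psi).
    apply: filterS (filterI Fphi Fpsi) => g phi_psi.
    by change (sat SM (copair (iota g) id) (fand phi psi)); rewrite sat_fand.
  by move=> a; rewrite sat_fand.
have embE g phi : sat SC (copair (embG j iota g) j) phi <->
    sat SM (copair (iota g) id) phi.
  by rewrite (sat_elementary C_monster') copair_comp.
suff dense : forall g theta phi, nbhs1_formulas theta -> ultra_formulas F phi ->
    exists m x y t, [/\ sat SC (copair m j) theta, sat SC (copair x j) phi,
      sat SC (copair y j) phi, stmul (embG j iota g) y t & stmul m x t].
  have [x y Gx Fx Fy|m [h [mT Hh cE]]] := Gstar_factor_coset nbhs1_formulas_directed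
    dirF dense HG _ Gc.
    apply: (invariant_right_coset subH bH iH Gx) => phi.
    have [Fphi|Fnphi] := in_ultra_setVsetC [set g | sat SM (copair (iota g) id) phi] Fultra.
      by split=> _; [exact: Fy|exact: Fx].
    by split=> h; [case: (Fx (fnot phi) Fnphi h)|case: (Fy (fnot phi) Fnphi h)].
  by exists m, h; split=> //; exact: realizes_mu.
move=> g theta phi [U [Uo U1 UE]] Fphi.
have [x [y [u [xphi yphi Uu gyux]]]] := Fdense g _ _ Fphi (open_nbhs_nbhs (conj Uo U1)).
exists (embG j iota u), (embG j iota x), (embG j iota y), (embG j iota (g * y)%g); split.
- apply/embE; rewrite -[sat _ _ _]/(solset SM id theta (iota u)) UE; by exists u.
- exact/embE.
- exact/embE.
- exact: (star_mul_embG C_monster' gammaM').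
- by rewrite gyux; exact: (star_mul_embG C_monster' gammaM').
Qed.

End Components.

Theorem proposition1p6 (L E : language) (M C K : Type)
    (SM : structure (lang_sum L E) M) (SC : structure (lang_sum L E) C)
    (j : M -> C) (n : nat) (G : topologicalGroupType) (iota : G -> 'I_n -> M)
    (M_inhabited : inhabited M)
    (G_definable : definable_group (reduct SM) iota)
    (G_hausdorff : hausdorff_space G)
    (G_basis : definable_nbhs_basis (reduct SM) iota)
    (opens_named : names_opens SM iota)
    (K_limit : strong_limit K)
    (K_large : card_lt [set: formula (lang_sum L E) (nat + M)] [set: K])
    (C_monster : monster K (reduct SM) (reduct SC) j)
    (C_monster' : monster K SM SC j) :
  [/\ def_top_extremely_amenable SM SC j iota ->
        Gstar SM SC j iota = G000_def_top SM SC j K iota /\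
        Gstar SM SC j iota = G00_def_top SM SC j K iota,
      extremely_amenable G ->
        Gstar SM SC j iota = G000_top SM SC j K iota /\
        Gstar SM SC j iota = G00_top SM SC j K iota
    & def_extremely_amenable SM SC j iota ->
        Gstar SM SC j iota = G000_M SM SC j K iota /\
        Gstar SM SC j iota = G00_M SM SC j K iota].
Proof.
have [iota_inj [delta deltaM] [gamma gammaM]] := G_definable.
have [sub000M b000M i000M] := G000_M_spec K_limit C_monster' M_inhabited
  K_large iota_inj deltaM gammaM.
have [sub00M b00M i00M] := G00_M_spec K_limit C_monster' M_inhabited
  K_large iota_inj deltaM gammaM.
have [sub000t b000t i000t mu000t] := G000_top_spec K_limit C_monster'
  M_inhabited K_large iota_inj deltaM gammaM.
have [sub00t b00t i00t mu00t] := G00_top_spec K_limit C_monster'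
  M_inhabited K_large iota_inj deltaM gammaM.
have [GG _ GM _] := Gstar_subgroup C_monster' iota_inj deltaM gammaM.
have setmul_sub A B : subgroup SM SC j iota A -> subgroup SM SC j iota B ->
    setmul SM SC j iota A B `<=` Gstar SM SC j iota.
  move=> [AG _ _ _] [BG _ _ _] _ [a Aa [b Bb <-]].
  by apply: GM; [exact: AG|exact: BG].
have eq_Gstar A : subgroup SM SC j iota A -> Gstar SM SC j iota `<=` A ->
    Gstar SM SC j iota = A.
  by move=> [AG _ _ _] GA; apply/seteqP.
split=> amen.
- have factor H := def_top_factor K_limit C_monster C_monster' K_large iota_inj deltaM
    gammaM opens_named amen (H := H).
  split; apply/seteqP; split; try exact: setmul_sub => c Gc.
    move=> c /(factor _ sub000M b000M i000M)[m [h [mum Hh ->]]].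
    by exists m; [exact: mu000t|exists h].
  move=> c /(factor _ sub00M b00M i00M)[m [h [mum Hh ->]]].
  by exists m; [exact: mu00t|exists h].
- have factor H := amenable_factor K_limit C_monster' K_large iota_inj deltaM
    gammaM opens_named amen (H := H).
  split; apply: eq_Gstar => // c.
    move=> /(factor _ sub000t b000t i000t)[m [h [mum Hh ->]]].
    by case: sub000t => _ _ HM _; apply: HM => //; exact: mu000t.
  move=> /(factor _ sub00t b00t i00t)[m [h [mum Hh ->]]].
  by case: sub00t => _ _ HM _; apply: HM => //; exact: mu00t.
- split; apply: eq_Gstar => //.
    exact: (def_amenable_sub K_limit C_monster C_monster' K_large iota_inj deltaM gammaM amen).
  exact: (def_amenable_sub K_limit C_monster C_monster' K_large iota_inj deltaM gammaM amen).
Qed.
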